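(* Let $X\subset\mathbb P^r_k$ be a variety of almost minimal degree which is the image $\varrho(\tilde X)$ of a (cone over a) rational normal scroll $\tilde X\subset\mathbb P^{r+1}_k$ with $\dim\operatorname{Sing}(\tilde X)=:h$ under a linear projection $\varrho:\mathbb P^{r+1}_k\setminus\{p\}\to\mathbb P^r_k$ from a point $p\in\mathbb P^{r+1}_k\setminus\tilde X$. Then: (a) $X$ is contained in a (cone over a) rational normal scroll $Y\subset\mathbb P^r_k$ such that $\operatorname{codim}_Y(X)=1$ and $h\le\dim\operatorname{Sing}(Y)\le h+3$; (b) $X$ is of arithmetic depth $t\le h+5$.
   Context: $k$ is an algebraically closed field, $r\ge2$, $S=k[x_0,\dots,x_r]$, $\mathbb P^r_k=\operatorname{Proj}S$. A non-degenerate reduced irreducible projective variety $X\subset\mathbb P^r_k$ of positive dimension is of almost minimal degree if $\deg X=\operatorname{codim}X+2$; its arithmetic depth is $\operatorname{depth}(S/I)$ where $I$ is its homogeneous vanishing ideal. A (cone over a) rational normal scroll in $\mathbb P^s_k=\operatorname{Proj}k[x_0,\dots,x_s]$ is, up to a linear change of coordinates, the subvariety whose homogeneous ideal is generated by the $2\times2$-minors of the $2\times(n-l+1)$-matrix $\begin{pmatrix} x_0\cdots x_{a_1-1} & x_{a_1+1}\cdots x_{a_2-1} & \cdots & x_{a_{l-1}+1}\cdots x_{n-1}\\ x_1\cdots x_{a_1} & x_{a_1+2}\cdots x_{a_2} & \cdots & x_{a_{l-1}+2}\cdots x_n\end{pmatrix}$ with $1\le n\le s$, $l\ge1$, $-1=a_0<a_1<\dots<a_l=n$,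 $a_i-a_{i-1}>1$; if $n<s$ it is a cone with vertex $\cong\mathbb P^{s-n-1}_k$. $\operatorname{Sing}(\cdot)$ denotes the singular locus (vertex), with $\mathbb P^{-1}_k=\emptyset$, $\dim\emptyset=-1$. *)

(* Defs.v *)
From mathcomp Require Import all_boot all_order all_algebra.
From mathcomp Require Import mpoly.
Set Implicit Arguments. Unset Strict Implicit. Unset Printing Implicit Defensive.
Import Order.TTheory GRing.Theory Num.Theory.
Local Open Scope ring_scope.

(* Conventions.  A (closed) subset X of P^{m-1}_k is represented by its affine
   cone  C : ('I_m -> k) -> Prop  in k^m;  S = {mpoly k[m]}. *)

Section Defs.
Variables (k : closedFieldType) (m : nat).
Notation S := {mpoly k[m]}.
Notation pt := ('I_m -> k).

(* homogeneous vanishing ideal I(X) (a polynomial vanishes on the cone iff all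
   its homogeneous components do, k being infinite) *)
Definition vanishing (C : pt -> Prop) : S -> Prop :=
  fun f => forall v, C v -> f.@[v] = 0.

Definition gen_ideal (gs : seq S) : S -> Prop :=
  fun f => exists cs : seq S, size cs = size gs /\
             f = \sum_(i < size gs) cs`_i * gs`_i.

Definition ideal_plus (I : S -> Prop) (gs : seq S) : S -> Prop :=
  fun f => exists g h, I g /\ gen_ideal gs h /\ f = g + h.

Definition zero_set (gs : seq S) : pt -> Prop :=
  fun v => forall g, g \in gs -> g.@[v] = 0.

Definition is_prime_ideal (I : S -> Prop) : Prop :=
  ~ I 1 /\ forall f g, I (f * g) -> I f \/ I g.

Definition closed_cone (C : pt -> Prop) : Prop :=
  forall v, C v <-> (forall f, vanishing C f -> f.@[v] = 0).

Definition nondegenerate (C : pt -> Prop) : Prop :=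
  forall c : 'I_m -> k, vanishing C (\sum_i c i *: 'X_i) -> forall i, c i = 0.

Definition homog_deg (d : nat) (f : S) : Prop := f \is ishomog1 d mdeg.

Definition lin_indep_mod (I : S -> Prop) (fs : seq S) : Prop :=
  forall c : 'I_(size fs) -> k,
    I (\sum_(i < size fs) c i *: fs`_i) -> forall i, c i = 0.

Definition hilb_fun (I : S -> Prop) (d h : nat) : Prop :=
  (exists fs : seq S, size fs = h /\ (forall f, f \in fs -> homog_deg d f)
                      /\ lin_indep_mod I fs) /\
  (forall fs : seq S, (forall f, f \in fs -> homog_deg d f) ->
                      lin_indep_mod I fs -> (size fs <= h)%N).

Definition hilb_poly (I : S -> Prop) (P : {poly rat}) : Prop :=
  exists d0 : nat, forall d : nat, (d0 <= d)%N ->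
    exists h : nat, hilb_fun I d h /\ P.[d%:R] = h%:R.

(* dimension of the projective algebraic set X (= degree of the Hilbert
   polynomial of S/I(X); the empty set gets dimension -1) *)
Definition proj_dim (C : pt -> Prop) (D : int) : Prop :=
  exists P, hilb_poly (vanishing C) P /\ D = (size P)%:Z - 1.

Definition dim_deg (C : pt -> Prop) (D : int) (e : nat) : Prop :=
  exists P, hilb_poly (vanishing C) P /\ D = (size P)%:Z - 1 /\
            lead_coef P * ((size P).-1)`!%:R = e%:R.

Definition regular_seq (I : S -> Prop) (fs : seq S) : Prop :=
  (forall f, f \in fs -> exists d, (0 < d)%N /\ homog_deg d f) /\
  (forall i : nat, (i < size fs)%N -> forall g : S,
      ideal_plus I (take i fs) (fs`_i * g) -> ideal_plus I (take i fs) g) /\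
  ~ ideal_plus I fs 1.

Definition arith_depth (C : pt -> Prop) (t : nat) : Prop :=
  (exists fs, regular_seq (vanishing C) fs /\ size fs = t) /\
  (forall fs, regular_seq (vanishing C) fs -> (size fs <= t)%N).

End Defs.

Definition almost_minimal_degree (k : closedFieldType) (r : nat)
  (C : ('I_r.+1 -> k) -> Prop) : Prop :=
  closed_cone C /\ is_prime_ideal (vanishing C) /\ nondegenerate C /\
  exists (D : int) (e : nat), dim_deg C D e /\ 1 <= D /\
     e%:Z = (r%:Z - D) + 2.

Definition scroll_data (s n : nat) (a : seq nat) : Prop :=
  (1 <= n <= s)%N /\ all (fun x => 0 < x)%N a /\
  sorted (fun x y => x.+1 < y)%N (rcons a n).
(* here a = [:: a_1; ...; a_(l-1)], a_0 = -1, a_l = n, l = size a + 1 *)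

(* column indices j (column (x_j, x_(j+1))) of the 2 x (n-l+1) matrix *)
Definition scroll_cols (n : nat) (a : seq nat) : seq nat :=
  [seq j <- iota 0 n | j \notin a].

Definition scroll_minors (k : closedFieldType) (s : nat)
  (L : 'I_s.+1 -> {mpoly k[s.+1]}) (n : nat) (a : seq nat) : seq {mpoly k[s.+1]} :=
  [seq L (inord q.1) * L (inord q.2.+1) - L (inord q.2) * L (inord q.1.+1)
    | q <- [seq (j, j') | j <- scroll_cols n a, j' <- scroll_cols n a]
    & (q.1 < q.2)%N].

(* C (a subset of P^s) is a (cone over a) rational normal scroll whose singular
   locus (vertex, P^(s-n-1)) has dimension vd. The linear change of coordinates
   is x_i |-> L_i = sum_j A i j x_j with A invertible. *)
Definition is_scroll (k : closedFieldType) (s : nat)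
  (C : ('I_s.+1 -> k) -> Prop) (vd : int) : Prop :=
  exists (A : 'M[k]_(s.+1)) (n : nat) (a : seq nat),
    A \in unitmx /\ scroll_data s n a /\ vd = s%:Z - n%:Z - 1 /\
    let L := fun i : 'I_s.+1 => \sum_(j < s.+1) A i j *: 'X_j in
    (forall v, C v <-> zero_set (scroll_minors L n a) v) /\
    (forall f, vanishing C f <-> gen_ideal (scroll_minors L n a) f).

Definition lapp (k : closedFieldType) (p q : nat) (M : 'M[k]_(p, q))
  (w : 'I_q -> k) : 'I_p -> k := fun i => \sum_j M i j * w j.

Definition projection_from (k : closedFieldType) (p q : nat) (M : 'M[k]_(p, q))
  (pt : 'I_q -> k) : Prop :=
  (exists j, pt j != 0) /\
  forall w, lapp M w = (fun _ => 0) <-> exists c : k, w = (fun j => c * pt j).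

(* Main.v *)
Require Import Defs.
From mathcomp Require Import all_boot all_order all_algebra.
From mathcomp Require Import mpoly.
From mathcomp Require Import perm ring lra zify.
From Stdlib Require Import Classical FunctionalExtensionality.

(* The scroll is cut out by the 2 x 2 minors of a 2 x c matrix of linear forms
   which is injective as a pencil.  As the centre p is off the scroll, the
   matrix has rank 2 at p, so the column combinations vanishing at p form a
   subspace V of codimension 2; they descend to linear forms on P^r.  The
   restricted pencil is still injective, and Kronecker's normal form turns it
   into the matrix of a scroll Y containing X.  Its entries span a subspace of
   codimension between 1 and 4 in the span of the original entries, which bounds
   the vertex of Y.  The ideal of a scroll is the kernel of a monomial map; this
   gives its primality and Hilbert polynomial, with dim = s + 1 - #columns.

   Let A inside B be the coordinate rings of X and of the original scroll, and y
   a linear form with y(p) = 1.  Then B = A + y A, so X and the scroll have the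
   same dimension, and every entry of a column in V multiplies y into A
   while y is not in A.  The first Koszul cohomology of A on these entries is
   therefore nonzero, so by Nakayama the Koszul cohomology of A on all variables
   is nonzero in degree 1 + (number of missing variables), and this bounds the
   length of regular sequences. *)

Set Implicit Arguments. Unset Strict Implicit. Unset Printing Implicit Defensive.
Import Order.TTheory GRing.Theory Num.Theory.
Local Open Scope ring_scope.

(** * Ideals, Hilbert functions and homogeneous components *)

Section Ideals.
Variables (k : closedFieldType) (m : nat).
Notation S := {mpoly k[m]}.
Implicit Types (I : S -> Prop) (f g h : S) (fs gs : seq S).

(** Injectivity of every combination s al + t be leaves only one kind of Kronecker block, and such a
    block is exactly a block of a scroll matrix; this is why the restricted pencil again defines a
    scroll. The constants are counts. Let n + 1 be the number of variables in the matrix of the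
    original scroll, so that h = r - n. Passing to V drops two columns, hence at most 2 + 2
    dimensions of entries; at least one is lost because all surviving entries vanish at p. So the
    matrix of Y involves between n - 3 and n variables, which puts the dimension of its vertex
    between h and h + 3 and leaves at most h + 4 variables outside it; the non-zero first cohomology
    then moves to degree at most h + 5. Two columns less with one coordinate less raise the
    dimension by exactly one. Almost minimal degree excludes a matrix with only two columns, for
    which V would be zero and X would have dimension r. *)

Definition ideal I :=
  [/\ I 0, forall f g, I f -> I g -> I (f + g) & forall f g, I g -> I (f * g)].

Lemma ideal0 I : ideal I -> I 0. Proof. by case. Qed.
Lemma idealD I f g : ideal I -> I f -> I g -> I (f + g).
Proof. by case=> _ + _; apply. Qed.
Lemma idealMl I f g : ideal I -> I g -> I (f * g).
Proof. by case=> _ _; apply. Qed.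
Lemma idealZ I c g : ideal I -> I g -> I (c *: g).
Proof. by rewrite -mul_mpolyC; apply: idealMl. Qed.
Lemma idealN I g : ideal I -> I g -> I (- g).
Proof. by rewrite -scaleN1r; apply: idealZ. Qed.
Lemma idealB I f g : ideal I -> I f -> I g -> I (f - g).
Proof. by move=> iI If Ig; apply: idealD => //; apply: idealN. Qed.
Lemma ideal_sum I (T : Type) (r : seq T) (P : pred T) (F : T -> S) :
  ideal I -> (forall i, P i -> I (F i)) -> I (\sum_(i <- r | P i) F i).
Proof. by case=> I0 ID _ IF; elim/big_ind: _. Qed.
Lemma ideal_sub_trans I f g h : ideal I -> I (f - g) -> I (g - h) -> I (f - h).
Proof. by move=> iI Ifg Igh; rewrite -(subrKA g); apply: idealD. Qed.
Lemma ideal_subC I f g : ideal I -> I (f - g) -> I (g - f).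
Proof. by move=> iI Ifg; rewrite -opprB; apply: idealN. Qed.

Lemma gen_ideal_nil f : gen_ideal [::] f <-> f = 0.
Proof.
split=> [[cs [_ ->]]|->]; first by rewrite big_ord0.
by exists [::]; rewrite big_ord0.
Qed.

Lemma gen_ideal_cons g gs f :
  gen_ideal (g :: gs) f <-> exists a h, gen_ideal gs h /\ f = a * g + h.
Proof.
split=> [[[|a cs] [//= [sz_cs] ->]]|[a [h [[cs [sz_cs ->]] ->]]]].
  exists a, (\sum_(i < size gs) cs`_i * gs`_i); split; first by exists cs.
  by rewrite big_ord_recl.
by exists (a :: cs); rewrite /= sz_cs big_ord_recl.
Qed.

Lemma gen_ideal_ideal gs : ideal (gen_ideal gs).
Proof.
elim: gs => [|g gs [IH0 IHD IHM]].
  split=> [|f h /gen_ideal_nil-> /gen_ideal_nil->|f h /gen_ideal_nil->];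
    by apply/gen_ideal_nil; rewrite ?addr0 ?mulr0.
split=> [|f h|f h].
- by apply/gen_ideal_cons; exists 0, 0; rewrite mul0r addr0.
- case/gen_ideal_cons=> a [x [Ix ->]] /gen_ideal_cons [b [y [Iy ->]]].
  by apply/gen_ideal_cons; exists (a + b), (x + y); split; [exact: IHD | ring].
- case/gen_ideal_cons=> a [x [Ix ->]].
  by apply/gen_ideal_cons; exists (f * a), (f * x); split; [exact: IHM | ring].
Qed.

Lemma gen_ideal_mem gs g : g \in gs -> gen_ideal gs g.
Proof.
elim: gs => // h gs IH; rewrite inE => /orP[/eqP->|/IH Ig].
  apply/gen_ideal_cons; exists 1, 0; split; last by rewrite mul1r addr0.
  exact: ideal0 (gen_ideal_ideal _).
by apply/gen_ideal_cons; exists 0, g; rewrite mul0r add0r.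
Qed.

Lemma gen_ideal_min I gs :
  ideal I -> (forall g, g \in gs -> I g) -> forall f, gen_ideal gs f -> I f.
Proof.
move=> iI; elim: gs => [_ f /gen_ideal_nil->|g gs IH Igs f]; first exact: ideal0.
case/gen_ideal_cons=> a [h [/IH Ih ->]]; apply: idealD => //.
  by apply: idealMl => //; apply: Igs; rewrite inE eqxx.
by apply: Ih => x xgs; apply: Igs; rewrite inE xgs orbT.
Qed.

Lemma vanishing_ideal (C : ('I_m -> k) -> Prop) : ideal (vanishing C).
Proof.
split=> [v _|f g If Ig v Cv|f g Ig v Cv]; first exact: meval0.
  by rewrite mevalD If ?Ig ?addr0.
by rewrite mevalM Ig ?mulr0.
Qed.

Lemma ideal_plus_nil I f : ideal_plus I [::] f <-> I f.
Proof.
split=> [[g [h [Ig [/gen_ideal_nil-> ->]]]]|If]; first by rewrite addr0.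
by exists f, 0; rewrite addr0; split=> //; split=> //; apply/gen_ideal_nil.
Qed.

Lemma gen_ideal_rcons gs g f :
  gen_ideal (rcons gs g) f <-> exists a h, gen_ideal gs h /\ f = a * g + h.
Proof.
elim: gs f => [|x gs IH] f; first exact: gen_ideal_cons.
rewrite rcons_cons gen_ideal_cons; split.
  case=> a [h [/IH[b [y [Iy ->]]] ->]]; exists b, (a * x + y).
  by split; [apply/gen_ideal_cons; exists a, y | ring].
case=> a [h [/gen_ideal_cons[b [y [Iy ->]]] ->]]; exists b, (a * g + y).
by split; [apply/IH; exists a, y | ring].
Qed.

Lemma ideal_plus_rcons I fs f g :
  ideal_plus I (rcons fs f) g <-> exists a b, ideal_plus I fs a /\ g = a + b * f.
Proof.
split=> [[x [h [Ix [/gen_ideal_rcons[b [y [Iy ->]]] ->]]]]|].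
  by exists (x + y), b; split; [exists x, y | ring].
case=> a [b [[x [y [Ix [Iy ->]]]] ->]].
exists x, (b * f + y); split=> //; split; last by ring.
by apply/gen_ideal_rcons; exists b, y.
Qed.

Lemma ideal_plus_ideal I fs : ideal I -> ideal (ideal_plus I fs).
Proof.
move=> iI; have jI := gen_ideal_ideal fs; split.
- by exists 0, 0; rewrite addr0; do 2?split; rewrite //; apply: ideal0.
- move=> f g [x [y [Ix [Iy ->]]]] [z [t [Iz [It ->]]]].
  exists (x + z), (y + t); split; first exact: idealD.
  by split; [exact: idealD | ring].
- move=> f g [x [y [Ix [Iy ->]]]].
  exists (f * x), (f * y); split; first exact: idealMl.
  by split; [exact: idealMl | ring].
Qed.

(** [Phi] identifies the degree [d] part of the quotient with k^n: preimages of the unit vectors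
    form an independent family, and every independent family is sent to independent rows. *)
Lemma hilb_fun_of_map I d n (Phi : S -> 'rV[k]_n) : linear Phi ->
  (forall f, homog_deg d f -> (I f <-> Phi f = 0)) ->
  (forall i, exists f, homog_deg d f /\ Phi f = delta_mx 0 i) ->
  hilb_fun I d n.
Proof.
move=> linPhi kerPhi surPhi.
have PhiD f g : Phi (f + g) = Phi f + Phi g by have := linPhi 1 f g; rewrite !scale1r.
have Phi0 : Phi 0 = 0 by apply: (addIr (Phi 0)); rewrite -PhiD !add0r.
have PhiZ c f : Phi (c *: f) = c *: Phi f by have := linPhi c f 0; rewrite Phi0 !addr0.
have Phi_sum := big_morph Phi PhiD Phi0.
have [F FP] := fin_all_exists surPhi; split.
  exists (codom F); rewrite size_codom card_ord; split=> //; split.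
    by move=> f /codomP[i ->]; case: (FP i).
  move=> c Ic i.
  have hom j : (j < n)%N -> homog_deg d ((codom F)`_j).
    move=> jn; have: (codom F)`_j \in codom F.
      by rewrite mem_nth // size_codom card_ord.
    by case/codomP=> l ->; case: (FP l).
  have szF : size (codom F) = n by rewrite size_codom card_ord.
  have szlt j : (j < size (codom F) -> j < n)%N by rewrite szF.
  have iP : (i < n)%N by apply/szlt/ltn_ord.
  have nthF j (jn : (j < n)%N) : (codom F)`_j = F (Ordinal jn).
    rewrite codomE (nth_map (Ordinal jn)) ?size_enum_ord //.
    by congr F; apply: val_inj; rewrite /= nth_enum_ord.
  have /kerPhi : homog_deg d (\sum_(i < size (codom F)) c i *: (codom F)`_i).
    apply: rpred_sum => j _; apply: rpredZ; apply: hom; apply: szlt; apply: ltn_ord.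
  case=> /(_ Ic) + _; rewrite Phi_sum.
  move/rowP/(_ (Ordinal iP)); rewrite summxE !mxE (bigD1 i) //= big1.
    rewrite PhiZ nthF (FP _).2 !mxE !eqxx mulr1 addr0 //.
  move=> j ne_ji; have jn : (j < n)%N by apply/szlt/ltn_ord.
  rewrite PhiZ nthF (FP _).2 !mxE !eqxx /=.
  suff /negPf-> : Ordinal iP != Ordinal jn by rewrite mulr0.
  by apply: contraNneq ne_ji => /(congr1 val) /= /esym/val_inj ->.
move=> fs homfs indfs.
pose N := \matrix_(i < size fs) Phi (fs`_i).
suff: row_free N by move/eqP <-; apply: rank_leq_col.
apply: inj_row_free => v vN0; apply/rowP => j; rewrite mxE.
apply: (indfs (v 0)); apply/kerPhi.
  by apply: rpred_sum => i _; apply: rpredZ; apply: homfs; apply: mem_nth.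
rewrite Phi_sum -[RHS]vN0 mulmx_sum_row; apply: eq_bigr => i _.
by rewrite PhiZ rowK.
Qed.

Lemma hilb_fun_span I d n : ideal I -> hilb_fun I d n ->
  exists fs, [/\ size fs = n, forall f, f \in fs -> homog_deg d f &
    forall f, homog_deg d f ->
      exists c : 'I_(size fs) -> k, I (f - \sum_(i < size fs) c i *: fs`_i)].
Proof.
move=> iI [[fs [szfs [homfs indfs]]] maxfs]; exists fs; split=> // f homf.
(* By maximality [f :: fs] satisfies a relation; its coefficient at [f] is non-zero because [fs] is
   independent, so it can be solved for [f]. *)
have : ~ lin_indep_mod I (f :: fs).
  move=> ind; suff: (size (f :: fs) <= n)%N by rewrite /= szfs ltnn.
  by apply: maxfs => // g; rewrite inE => /orP[/eqP->|/homfs].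
move=> nind; have [c nc] := not_all_ex_not _ _ nind.
have [Ic nc0] := imply_to_and _ _ nc; have [i0 ci0] := not_all_ex_not _ _ nc0.
rewrite big_ord_recl /= in Ic.
have [c0|nzc0] := eqVneq (c ord0) 0.
  case: ci0; case: (unliftP ord0 i0) => [j|] -> //.
  apply: (indfs (fun j => c (lift ord0 j))).
  by move: Ic; rewrite c0 scale0r add0r.
exists (fun i => - (c ord0)^-1 * c (lift ord0 i)).
have := idealZ (c ord0)^-1 iI Ic; congr I.
rewrite scalerDr scalerA mulVf // scale1r scaler_sumr -sumrN; congr +%R.
by apply: eq_bigr => i _; rewrite scalerA mulNr scaleNr opprK.
Qed.

End Ideals.

Section Homogeneous.
Variables (k : closedFieldType) (m : nat).
Notation S := {mpoly k[m]}.

Lemma poly_ext0 (p : {poly k}) : (forall x, p.[x] = 0) -> p = 0.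
Proof.
move=> p0; apply/eqP; apply: contraT => /closed_nonrootP[x].
by rewrite rootE p0 eqxx.
Qed.

Lemma dhomog_meval_scale d (f : S) c v :
  homog_deg d f -> f.@[fun i => c * v i] = c ^+ d * f.@[v].
Proof.
move=> /dhomogP hf; rewrite !mevalE mulr_sumr !big_seq; apply: eq_bigr => a /hf <-.
under eq_bigr do rewrite exprMn.
by rewrite big_split /= prodrXr -mdegE mulrCA.
Qed.

Lemma meval_scale (f : S) c v :
  f.@[fun i => c * v i] = \sum_(d < msize f) c ^+ d * (pihomog mdeg d f).@[v].
Proof.
rewrite [in LHS](pihomog_partitionE (leqnn (msize f))) raddf_sum /=.
by apply: eq_bigr => d _; apply: dhomog_meval_scale; apply: pihomogP.
Qed.

Lemma pihomog_oversize d (f : S) : (msize f <= d)%N -> pihomog mdeg d f = 0.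
Proof.
move=> le_fd; rewrite [f](pihomog_partitionE (leqnn (msize f))) linear_sum /=.
apply: big1 => i _; apply: (@pihomog_ne0 _ _ _ i) => //; last exact: pihomogP.
by rewrite neq_ltn (leq_trans (ltn_ord i)).
Qed.

(** On the line through [v], the value of [f] is a polynomial in [c] whose coefficients are the
    values of the homogeneous parts, and a polynomial vanishing on all of [k] is zero. *)
Lemma homog_parts_vanish (f : S) (v : 'I_m -> k) d :
  (forall c, f.@[fun i => c * v i] = 0) -> (pihomog mdeg d f).@[v] = 0.
Proof.
move=> f0; pose p := \poly_(i < msize f) (pihomog mdeg i f).@[v].
have : p = 0.
  apply: poly_ext0 => x; rewrite horner_poly -[RHS](f0 x) meval_scale.
  by apply: eq_bigr => i _; rewrite mulrC.
move/polyP/(_ d); rewrite coef_poly coef0; case: ltnP => // le_d _.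
by rewrite pihomog_oversize ?meval0.
Qed.

Lemma vanishing_pihomog (C : ('I_m -> k) -> Prop) d f :
  (forall v c, C v -> C (fun i => c * v i)) ->
  vanishing C f -> vanishing C (pihomog mdeg d f).
Proof. by move=> coneC If v Cv; apply: homog_parts_vanish => c; apply/If/coneC. Qed.

Lemma pihomogM1 d (x f : S) :
  homog_deg 1 x -> pihomog mdeg d.+1 (x * f) = x * pihomog mdeg d f.
Proof.
move=> hx; rewrite {1}[f](pihomog_partitionE (leqnn (msize f))) mulr_sumr linear_sum /=.
have hom i : x * pihomog mdeg i f \is i.+1.-homog.
  by rewrite -[i.+1]add1n; apply: dhomogM => //; apply: pihomogP.
have [le_fd|lt_df] := leqP (msize f) d.
  rewrite pihomog_oversize // mulr0; apply: big1 => i _.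
  apply: (@pihomog_ne0 _ _ _ i.+1) => //.
  by rewrite eqSS neq_ltn (leq_trans (ltn_ord i)).
rewrite (bigD1 (Ordinal lt_df)) //= pihomog_dE // big1 ?addr0 // => i ne_id.
by apply: (@pihomog_ne0 _ _ _ i.+1) => //; rewrite eqSS.
Qed.

Lemma pihomog0M1 (x f : S) : homog_deg 1 x -> pihomog mdeg 0 (x * f) = 0.
Proof.
move=> hx; rewrite [f](pihomog_partitionE (leqnn (msize f))) mulr_sumr linear_sum /=.
apply: big1 => i _; apply: (@pihomog_ne0 _ _ _ i.+1) => //.
by rewrite -[i.+1]add1n; apply: dhomogM => //; apply: pihomogP.
Qed.

End Homogeneous.

(** * Koszul cohomology and regular sequences *)

Section KoszulDifferential.
Variable R : comNzRingType.
Implicit Types (xs cs : seq R) (a b : bitseq -> R) (w u : bitseq).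

(* A Koszul cochain on [xs] assigns a coefficient to each bit mask of length
   [size xs], the masks of weight [i] being the basis of the i-th exterior
   power; values on masks of other lengths are junk. *)
Fixpoint koszul xs a w : R :=
  match xs, w with
  | x :: xs', b :: w' =>
      if b then x * a (false :: w') - koszul xs' (fun u => a (true :: u)) w'
      else koszul xs' (fun u => a (false :: u)) w'
  | _, _ => 0
  end.

(** Interior product with the vector [cs]. It is the homotopy through which the combination of [xs]
    with coefficients [cs] acts as zero on Koszul cohomology. *)
Fixpoint contraction cs a w : R :=
  match cs, w with
  | c :: cs', b :: w' =>
      if b then - contraction cs' (fun u => a (true :: u)) w'
      else contraction cs' (fun u => a (false :: u)) w' + c * a (true :: w')
  | _, _ => 0
  end.

Lemma koszul_linear xs c a b w :
  koszul xs (fun u => c * a u + b u) w = c * koszul xs a w + koszul xs b w.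
Proof.
elim: xs a b w => [|x xs IH] a b [|[] w] /=; rewrite ?mulr0 ?addr0 ?IH //.
by ring.
Qed.

Lemma eq_koszul xs a b w :
  (forall u, size u = size w -> (count id u).+1 = count id w -> a u = b u) ->
  koszul xs a w = koszul xs b w.
Proof.
elim: xs a b w => [|x xs IH] a b [|[] w] //= eq_ab.
  congr (_ * _ - _); first by apply: eq_ab => //=; rewrite add0n add1n.
  by apply: IH => u su cu; apply: eq_ab; rewrite /= ?su ?add1n ?cu.
by apply: IH => u su cu; apply: eq_ab; rewrite /= ?su.
Qed.

Lemma koszul0 xs w : koszul xs (fun=> 0) w = 0.
Proof. by elim: xs w => [|x xs IH] [|[] w] //=; rewrite IH mulr0 subrr. Qed.

Lemma koszulK xs a w : koszul xs (koszul xs a) w = 0.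
Proof.
elim: xs a w => [|x xs IH] a [|[] w] //=.
rewrite koszul_linear.
suff -> : koszul xs (fun u => - koszul xs (fun v => a (true :: v)) u) w = 0.
  by rewrite addr0 subrr.
rewrite (@eq_koszul _ _
  (fun u => -1 * koszul xs (fun v => a (true :: v)) u + 0)).
  by rewrite koszul_linear koszul0 IH mulr0 addr0.
by move=> u _ _; rewrite mulN1r addr0.
Qed.

Lemma koszul_homotopy xs cs a w : size cs = size xs -> size w = size xs ->
  koszul xs (contraction cs a) w + contraction cs (koszul xs a) w
  = (\sum_(i < size xs) cs`_i * xs`_i) * a w.
Proof.
elim: xs cs a w => [|x xs IH] [|c cs] a [|b w] //=.
  by rewrite big_ord0 mul0r addr0.
case=> sc [sw]; rewrite big_ord_recl mulrDl.
set s := (X in _ = _ + X * _).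
have {}IH a' : s * a' w = koszul xs (contraction cs a') w + contraction cs (koszul xs a') w.
  by rewrite IH.
have lin a1 a2 : koszul xs (fun u => contraction cs a1 u + c * a2 u) w
    = koszul xs (contraction cs a1) w + c * koszul xs a2 w.
  rewrite addrC -koszul_linear; apply: eq_koszul => u _ _; exact: addrC.
have kN a1 : koszul xs (fun u => - a1 u) w = - koszul xs a1 w.
  rewrite -mulN1r -[RHS]addr0 -(koszul0 xs w) -koszul_linear.
  by apply: eq_koszul => u _ _; rewrite mulN1r addr0.
have cB a1 a2 : contraction cs (fun u => x * a1 u - a2 u) w
    = x * contraction cs a1 w - contraction cs a2 w.
  clear -R; elim: cs w a1 a2 => [|d ds IH] [|[] w] a1 a2 /=;
    rewrite ?IH; ring.
by case: b; [have := IH (fun u => a (true :: u)) | have := IH (fun u => a (false :: u))] => /= ->;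
  rewrite ?lin ?cB ?kN; ring.
Qed.

Lemma koszul_weight0 xs b w : count id w = 0 -> koszul xs b w = 0.
Proof. by elim: xs b w => [|x xs IH] b [|[] w] //= cw; rewrite IH. Qed.

Lemma koszul_weight1 xs b w : size w = size xs -> count id w = 1%N ->
  koszul xs b w = xs`_(index true w) * b (nseq (size xs) false).
Proof.
elim: xs b w => [|x xs IH] b [|[] w] //= [sw] cw; last by rewrite IH.
have {}cw : count id w = 0 by case: cw.
rewrite koszul_weight0 // subr0; congr (_ * b (_ :: _)); rewrite -sw.
by elim: w cw {sw} => //= -[] //= w IHw /IHw {1}->.
Qed.

Lemma koszul_sum (T : Type) (r : seq T) (F : T -> bitseq -> R) xs w :
  koszul xs (fun u => \sum_(j <- r) F j u) w = \sum_(j <- r) koszul xs (F j) w.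
Proof.
elim: r => [|j r IH].
  rewrite big_nil; apply: etrans (koszul0 xs w).
  by apply: eq_koszul => u _ _; rewrite big_nil.
rewrite big_cons -IH -[koszul xs (F j) w]mul1r -koszul_linear.
by apply: eq_koszul => u _ _; rewrite big_cons mul1r.
Qed.

End KoszulDifferential.

Lemma koszul_morph (R R' : comNzRingType) (f : {rmorphism R -> R'}) xs a w :
  f (koszul xs a w) = koszul (map f xs) (fun u => f (a u)) w.
Proof.
elim: xs a w => [|x xs IH] a [|[] w] /=; rewrite ?rmorph0 //.
by rewrite rmorphB rmorphM IH.
Qed.

Section KoszulCohomology.
Variables (k : closedFieldType) (m : nat).
Notation S := {mpoly k[m]}.
Implicit Types (I : S -> Prop) (f g h : S) (xs cs fs : seq S) (w u : bitseq).

(** Exactness in degree [i] of the Koszul complex of S/I, with cochains lifted to S and equalities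
    read modulo [I]. In degree 0 coboundaries are zero, so there it says that only elements of [I]
    are multiplied into [I] by all of [xs]. *)
Definition koszul_exact I xs i := forall a : bitseq -> S,
  (forall w, size w = size xs -> count id w = i.+1 -> I (koszul xs a w)) ->
  exists b, forall w, size w = size xs -> count id w = i -> I (a w - koszul xs b w).

Lemma koszul_ideal I xs a w : ideal I ->
  (forall u, size u = size w -> (count id u).+1 = count id w -> I (a u)) ->
  I (koszul xs a w).
Proof.
move=> iI; elim: xs a w => [|x xs IH] a [|[] w] /= Ia; try exact: ideal0.
  apply: idealB => //; first by apply: idealMl => //; apply: Ia; rewrite //= add0n add1n.
  by apply: IH => u su cu; apply: Ia; rewrite /= ?su ?add1n ?cu.
by apply: IH => u su cu; apply: Ia; rewrite /= ?su.
Qed.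

Lemma contraction_ideal I xs a w : ideal I ->
  (forall u, size u = size w -> count id u = (count id w).+1 -> I (a u)) ->
  I (contraction xs a w).
Proof.
move=> iI; elim: xs a w => [|x xs IH] a [|[] w] /= Ia; try exact: ideal0.
  apply: idealN => //.
  by apply: IH => u su cu; apply: Ia; rewrite /= ?su ?cu ?add1n.
apply: idealD => //; last by apply: idealMl => //; apply: Ia; rewrite //= add0n add1n.
by apply: IH => u su cu; apply: Ia; rewrite /= ?su ?cu ?add0n.
Qed.

(** [f] times a 0-cocycle is the contraction of its coboundary, hence lies in [I]; regularity of [f]
    cancels the factor. *)
Lemma koszul_exact0 I xs f : ideal I -> gen_ideal xs f ->
  (forall g, I (f * g) -> I g) -> koszul_exact I xs 0.
Proof.
move=> iI [cs [scs ->]] reg a cyc; exists (fun=> 0) => w sw cw.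
rewrite koszul0 subr0; apply: reg; rewrite -koszul_homotopy // koszul_weight0 //.
rewrite add0r; apply: contraction_ideal => // u su cu.
by apply: cyc; rewrite ?su // cu cw.
Qed.

(** The contraction of an (i+1)-cocycle modulo [I] is an i-cocycle modulo [J] = I + (f), hence the
    coboundary of some [b] plus a multiple e f. Taking coboundaries gives f a = f d(e) modulo [I],
    and [f] cancels. *)
Lemma koszul_exactS I (J : S -> Prop) xs f i : ideal I -> gen_ideal xs f ->
  (forall g, I (f * g) -> I g) ->
  (forall g, J g <-> exists a b, I a /\ g = a + b * f) ->
  koszul_exact J xs i -> koszul_exact I xs i.+1.
Proof.
move=> iI [cs [scs f_def]] reg JP exJ a cyc.
have IJ g : I g -> J g by move=> Ig; apply/JP; exists g, 0; rewrite mul0r addr0.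
have fa w : size w = size xs -> count id w = i.+1 ->
    I (f * a w - koszul xs (contraction cs a) w).
  move=> sw cw; rewrite f_def -(koszul_homotopy _ scs sw) addrC addKr.
  apply: contraction_ideal => // u su cu.
  by apply: cyc; rewrite ?su // cu cw.
have [|b bP] := exJ (contraction cs a).
  move=> w sw cw; apply/JP; exists (koszul xs (contraction cs a) w - f * a w), (a w).
  by split; [rewrite -opprB; apply: idealN => //; exact: fa | ring].
have eP w : exists e : S, size w = size xs -> count id w = i ->
    I (contraction cs a w - koszul xs b w - e * f).
  have [/eqP sw|/eqP nsw] := boolP (size w == size xs); last by exists 0.
  have [/eqP cw|/eqP ncw] := boolP (count id w == i); last by exists 0.
  have /JP[x [e [Ix ->]]] := bP w sw cw.
  by exists e => _ _; rewrite addrK.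
(* Only finitely many masks matter: [e] is chosen on tuples and set to 0 elsewhere. *)
have [e {}eP] : exists e : bitseq -> S, forall w, size w = size xs ->
    count id w = i -> I (contraction cs a w - koszul xs b w - e w * f).
  pose T := (size xs).-tuple bool.
  have [e0 e0P] := fin_all_exists (fun t : T => eP t).
  exists (fun w => if insub w is Some t then e0 t else 0) => w sw cw.
  case: insubP => [t _ tw|]; last by rewrite sw eqxx.
  by have := e0P t; rewrite tw; apply.
exists e => w sw cw; apply: reg; rewrite mulrBr.
apply: (@ideal_sub_trans _ _ _ _ (koszul xs (contraction cs a) w)) => //.
  exact: fa.
have := @koszul_ideal I xs
  (fun u => (-1) * (f * e u + koszul xs b u) + contraction cs a u) w iI.
rewrite koszul_linear koszul_linear koszulK addr0 mulN1r addrC; apply.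
move=> u su cu; rewrite mulN1r addrC opprD [- (f * _) - _]addrC addrA [f * _]mulrC.
apply: eP; first by rewrite su.
by move: cu; rewrite cw => -[].
Qed.

(** The induction runs from the end of the sequence: modulo the first [j] elements, cohomology
    vanishes below the number [n] of elements left, and each step backwards gains one degree. *)
Lemma regular_seq_koszul_exact I xs fs i : ideal I ->
  (forall f, f \in fs -> gen_ideal xs f) -> regular_seq I fs ->
  (i < size fs)%N -> koszul_exact I xs i.
Proof.
move=> iI span_fs [_ [reg _]] lt_i.
suff main n j : (j + n = size fs)%N -> forall i, (i < n)%N ->
    koszul_exact (ideal_plus I (take j fs)) xs i.
  have := main (size fs) 0 (add0n _) i lt_i; rewrite take0 => ex a cyc.
  have [|b bP] := ex a; first by move=> w sw cw; apply/ideal_plus_nil; exact: cyc.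
  by exists b => w sw cw; apply/ideal_plus_nil; apply: bP.
clear i lt_i; elim: n j => // n IH j szj i lt_in.
have ltj : (j < size fs)%N by rewrite -szj addnS ltnS leq_addr.
have spj : gen_ideal xs fs`_j by apply/span_fs/mem_nth.
have iJ := ideal_plus_ideal (take j fs) iI.
case: i lt_in => [|i] lt_in; first by apply: (koszul_exact0 iJ spj) => g; apply: reg.
apply: (koszul_exactS iJ spj (J := ideal_plus I (take j.+1 fs))).
- by move=> g; apply: reg.
- by move=> g; rewrite (take_nth 0 ltj) ideal_plus_rcons.
- by apply: IH => //; rewrite addSnnS.
Qed.

Lemma pihomog_koszul xs b w d : (forall x, x \in xs -> homog_deg 1 x) ->
  pihomog mdeg d (koszul xs b w) =
  koszul xs (fun u => if d is e.+1 then pihomog mdeg e (b u) else 0) w.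
Proof.
elim: xs b w => [|x xs IH] b [|[] w] /= hom; rewrite ?linear0 //.
  rewrite linearB /= IH; last by move=> y ys; apply: hom; rewrite inE ys orbT.
  congr (_ - _); have homx : homog_deg 1 x by apply: hom; rewrite inE eqxx.
  by case: d {IH} => [|e]; rewrite ?mulr0 (pihomog0M1, pihomogM1).
by rewrite IH // => y ys; apply: hom; rewrite inE ys orbT.
Qed.

Lemma pihomog_expM1 d n (x f : S) : homog_deg 1 x -> (d < n)%N ->
  pihomog mdeg d (x ^+ n * f) = 0.
Proof.
move=> hx; elim: n d f => // n IH [|d] f lt_dn; rewrite exprS -mulrA.
  exact: pihomog0M1.
by rewrite pihomogM1 // IH ?mulr0.
Qed.

(* Graded Nakayama: the long exact sequence would make multiplication by [x]
   surjective on the i-th cohomology, hence every class divisible by all powers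
   of [x], which is impossible degree by degree. *)
Lemma koszul_exact_behead I x xs i : ideal I ->
  (forall d f, I f -> I (pihomog mdeg d f)) ->
  (forall y, y \in x :: xs -> homog_deg 1 y) ->
  koszul_exact I (x :: xs) i.+1 -> koszul_exact I xs i.
Proof.
move=> iI homI hom ex a0 cyc0.
have homx : homog_deg 1 x by apply: hom; rewrite inE eqxx.
have homxs y : y \in xs -> homog_deg 1 y by move=> ys; apply: hom; rewrite inE ys orbT.
pose cyc a := forall w, size w = size xs -> count id w = i.+1 -> I (koszul xs a w).
have step a : cyc a -> exists a' b, cyc a' /\ forall w, size w = size xs ->
    count id w = i -> I (a w - (x * a' w + koszul xs b w)).
  (* [a] is placed on the masks containing [x]. Of a primitive [B], the half without [x] is a new
     cocycle, and [a] is [x] times it up to a coboundary, given by the other half. *)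
  move=> cyca; have [|B BP] := ex (fun w => if w is true :: u then a u else 0).
    move=> [|[] w] //= [sw] cw; last by rewrite koszul0; apply: ideal0.
    rewrite mulr0 sub0r; apply: idealN => //; apply: cyca => //.
    by case: cw; rewrite add0n.
  exists (fun u => B (false :: u)), (fun u => -1 * B (true :: u) + 0); split.
    move=> w sw cw; have /= := BP (false :: w); rewrite sub0r => /(_ _ _)IB.
    by rewrite -[koszul _ _ _]opprK; apply: idealN => //; apply: IB; rewrite ?sw ?cw.
  move=> w sw cw; rewrite koszul_linear koszul0 addr0 mulN1r.
  by have /= := BP (true :: w); apply; rewrite ?sw ?cw.
have steps n a : cyc a -> exists a' b, cyc a' /\ forall w, size w = size xs ->
    count id w = i -> I (a w - (x ^+ n * a' w + koszul xs b w)).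
  elim: n a => [|n IH] a cyca.
    exists a, (fun=> 0); split=> // w _ _.
    by rewrite koszul0 addr0 expr0 mul1r subrr; apply: ideal0.
  have [a1 [b1 [cyc1 eq1]]] := IH a cyca; have [a2 [b2 [cyc2 eq2]]] := step a1 cyc1.
  exists a2, (fun u => x ^+ n * b2 u + b1 u); split=> // w sw cw.
  rewrite koszul_linear; apply: (ideal_sub_trans iI (eq1 w sw cw)).
  have := idealMl (x ^+ n) iI (eq2 w sw cw); congr I; rewrite exprSr; ring.
have bd d : exists b, forall w, size w = size xs -> count id w = i ->
    I (pihomog mdeg d (a0 w) - koszul xs b w).
  have [a1 [b1 [cyc1 eq1]]] := steps d.+1 a0 cyc0.
  exists (fun u => if d is e.+1 then pihomog mdeg e (b1 u) else 0) => w sw cw.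
  rewrite -(pihomog_koszul b1 w d homxs).
  have := homI d _ (eq1 w sw cw).
  by rewrite linearB linearD /= pihomog_expM1 // add0r; apply.
(* [D] bounds the degrees of all coefficients, so finitely many primitives of homogeneous parts add
   up to one for [a0]. *)
pose D := (\max_(w : (size xs).-tuple bool) msize (a0 w))%N.
have [b bP] := fin_all_exists (fun d : 'I_D => bd d).
exists (fun u => \sum_(d < D) b d u) => w sw cw.
rewrite koszul_sum; have le_D : (msize (a0 w) <= D)%N.
  have szt : size w == size xs by rewrite sw.
  exact: (@leq_bigmax _ (fun w : (size xs).-tuple bool => msize (a0 w)) (Tuple szt)).
rewrite {1}(pihomog_partitionE le_D) -sumrB; apply: ideal_sum => // d _.
exact: bP.
Qed.

(* If multiplication by [y] maps every member of [xs] into the coordinate ring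
   of the image of [C] under [e], then [y] times the Koszul differential of 1 is
   a 1-cocycle; it bounds only when [y] itself lies in that ring. *)
Lemma koszul_exact1_conductor (W : Type) (C : W -> Prop) (e : W -> 'I_m -> k)
    (y : W -> k) I xs (Gs : seq S) :
  (forall f, I f <-> forall q, C q -> f.@[e q] = 0) ->
  size Gs = size xs ->
  (forall q j, C q -> (j < size xs)%N -> (Gs`_j).@[e q] = (xs`_j).@[e q] * y q) ->
  koszul_exact I xs 1 ->
  exists b : S, forall q j, C q -> (j < size xs)%N ->
    (xs`_j).@[e q] * (y q - b.@[e q]) = 0.
Proof.
move=> IP sG GP ex; pose a u := Gs`_(index true u).
have aP q u : C q -> size u = size xs -> count id u = 1%N ->
    (a u).@[e q] = koszul (map (meval (e q)) xs) (fun=> y q) u.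
  move=> Cq su cu; have ltu : (index true u < size xs)%N.
    by rewrite -su index_mem -has_pred1 has_count -cu; apply/eq_leq/eq_count => -[].
  by rewrite koszul_weight1 ?size_map // (nth_map 0) // GP.
have [|b bP] := ex a.
  move=> u su cu; apply/IP => q Cq; rewrite koszul_morph.
  rewrite (@eq_koszul _ _ _ (koszul (map (meval (e q)) xs) (fun=> y q))) ?koszulK //.
  by move=> v sv cv; apply: aP; rewrite ?sv //; move: cv; rewrite cu => -[].
exists (b (nseq (size xs) false)) => q j Cq ltj.
pose u := nseq j false ++ true :: nseq (size xs - j.+1) false.
have su : size u = size xs by rewrite size_cat /= !size_nseq addnS -addSn subnKC.
have cu : count id u = 1%N by rewrite count_cat /= !count_nseq.
have iu : index true u = j.
  by rewrite index_cat mem_nseq andbF size_nseq /= addn0.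
have /IP/(_ q Cq) := bP u su cu.
rewrite koszul_weight1 // mevalB mevalM aP // koszul_weight1 ?size_map // iu.
by rewrite (nth_map 0) // mulrBr.
Qed.

End KoszulCohomology.

(** * Injective pencils *)

Section Pencils.
Variable k : closedFieldType.

Lemma stable_eigenvector (U : vectType k) (V : {vspace U}) (phi : 'End(U)) :
  V != 0%VS -> (forall v, v \in V -> phi v \in V) ->
  exists v a, [/\ v \in V, v != 0 & phi v = a *: v].
Proof.
move=> V0 stabV.
pose n : nat := \dim V; pose b := vbasis V.
pose M := \matrix_(i < n, j < n) coord b j (phi b`_i).
have phib (i : 'I_n) : phi b`_i = \sum_j M i j *: b`_j.
  rewrite {1}(coord_vbasis (stabV _ (vbasis_mem (mem_nth 0 _)))) ?size_tuple //.
  by apply: eq_bigr => j _; rewrite mxE.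
have [a aP] : exists a, root (char_poly M) a.
  by apply/closed_rootP; rewrite size_char_poly eqSS dimv_eq0.
have /eigenvalueP[c cM c0] : eigenvalue M a by rewrite eigenvalue_root_char.
exists (\sum_i c 0 i *: b`_i), a; split.
- by apply: rpred_sum => i _; apply: rpredZ; apply/vbasis_mem/mem_nth; rewrite size_tuple.
- apply: contra_neq c0 => c0; apply/rowP => i; rewrite mxE.
  by have /freeP/(_ (c 0) c0 i) := basis_free (vbasisP V).
rewrite linear_sum /= scaler_sumr.
transitivity (\sum_i \sum_j (c 0 i * M i j) *: b`_j).
  by apply: eq_bigr => i _; rewrite linearZ /= phib scaler_sumr; apply: eq_bigr => j _; rewrite scalerA.
rewrite exchange_big /=; apply: eq_bigr => j _.
rewrite scalerA -scaler_suml; congr (_ *: _).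
by move/rowP: cM => /(_ j); rewrite !mxE.
Qed.

Definition links (U W : vectType k) (al be : 'Hom(U, W)) (c : seq U) :=
  forall j, (j.+1 < size c)%N -> be c`_j = al c`_j.+1.

(** The entries of one block of a scroll matrix: its columns are the pairs (al v, be v) for [v] in
    the chain, and [links] makes each lower entry the upper entry of the next column. *)
Definition chain_forms (U W : vectType k) (al be : 'Hom(U, W)) (c : seq U) : seq W :=
  rcons (map al c) (be (last 0 c)).

Lemma perm_flatten_rcons (T : eqType) (I : Type) (f : I -> seq T) (g : I -> T) (s : seq I) :
  perm_eq (flatten [seq rcons (f i) (g i) | i <- s])
          (flatten (map f s) ++ map g s).
Proof.
elim: s => //= i s IH; rewrite -cats1 -!catA perm_cat2l.
by rewrite perm_sym -[g i :: map g s]cat1s perm_catCA /= perm_cons perm_sym.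
Qed.

(* Kronecker's normal form of an injective pencil: the vectors [v] of [V] with
   [be v] in [al V] carry the smaller injective pencil [(id, al^-1 be)], whose
   chains, prolonged by one step and completed to a basis of [V], are chains for
   [(al, be)]. *)
Lemma kronecker_chains (U W : vectType k) (al be : 'Hom(U, W)) (V : {vspace U}) :
  (forall v s t, v \in V -> (s != 0) || (t != 0) -> s *: al v + t *: be v = 0 -> v = 0) ->
  exists cs : seq (seq U),
    [/\ all (fun c => c != [::]) cs, basis_of V (flatten cs),
        forall c, c \in cs -> links al be c
      & free (flatten (map (chain_forms al be) cs))].
Proof.
have [n] := ubnP (\dim V); elim: n U W al be V => // n IH U W al be V.
rewrite ltnS => dimV inj.
have kerI (f : 'Hom(U, W)) : (forall v, v \in V -> f v = 0 -> v = 0) ->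
    (V :&: lker f = 0)%VS.
  move=> injf; apply/eqP; rewrite -subv0; apply/subvP => v.
  by rewrite memv_cap memv_ker memv0 => /andP[Vv /eqP fv]; rewrite (injf v).
have injal v : v \in V -> al v = 0 -> v = 0.
  move=> Vv av; apply: (inj v 1 0) => //; first by rewrite oner_eq0.
  by rewrite av scale0r scaler0 addr0.
have injbe v : v \in V -> be v = 0 -> v = 0.
  move=> Vv bv; apply: (inj v 0 1) => //; first by rewrite oner_eq0 orbT.
  by rewrite bv scale0r scaler0 addr0.
have [V0|nzV] := eqVneq V 0%VS.
  exists [::]; split=> //=; last exact: nil_free.
  by rewrite V0 nil_basis.
pose V1 := (V :&: be @^-1: (al @: V))%VS.
(* The projections onto [V] turn al^-1 be into a total endomorphism [phi] with values in [V]; it has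
   the intended meaning on [V1]. *)
pose al' := (al \o projv V)%VF.
pose phi := (projv V \o (al'^-1 \o be))%VF.
have phiV v : phi v \in V by rewrite /phi comp_lfunE memv_proj.
have alphi v : v \in V1 -> al (phi v) = be v.
  rewrite memv_cap => /andP[_]; rewrite -memv_preim => /memv_imgP[u Vu buE].
  have bL : be v \in limg al'.
    apply/memv_imgP; exists u; first exact: memvf.
    by rewrite comp_lfunE /= projv_id.
  by have := limg_lfunVK bL; rewrite !comp_lfunE.
have V1V : (V1 <= V)%VS by apply: capvSl.
have ltV1 : (\dim V1 < n)%N.
  apply: leq_trans dimV; rewrite ltn_neqAle dimvS // andbT.
  apply: contraNneq nzV => eqdim; apply: contraT => nzV.
  (* If [V1] were all of [V], an eigenvector v of [phi] with eigenvalue a would satisfy be v = a al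
     v, against injectivity. *)
  have eqV : V1 = V by apply/eqP; rewrite eqEdim V1V eqdim /=.
  have [v [a [Vv v0 pv]]] := stable_eigenvector nzV (fun v _ => phiV v).
  case/eqP: v0; apply: (inj v a (-1)) => //; first by rewrite oppr_eq0 oner_eq0 orbT.
  have := alphi v; rewrite eqV => /(_ Vv) <-; rewrite pv linearZ /=.
  by rewrite scaleN1r subrr.
have inj1 v s t : v \in V1 -> (s != 0) || (t != 0) ->
    s *: \1%VF v + t *: phi v = 0 -> v = 0.
  move=> V1v st0; rewrite id_lfunE => eq0.
  apply: (inj v s t) => //; first exact: (subvP V1V).
  by rewrite -(alphi v V1v); have := congr1 al eq0; rewrite linear0 linearD !linearZ.
have [cs1 [nz1 bas1 link1 free1]] := IH _ _ \1%VF phi V1 ltV1 inj1.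
have map1 (c : seq U) : map \1%VF c = c by rewrite (eq_map (@id_lfunE _ _)) map_id.
set B1 := flatten _ in free1.
have B1V : (<<B1>> <= V)%VS.
  apply/span_subvP => x /flatten_mapP[c csc].
  rewrite mem_rcons inE => /orP[/eqP->|]; first exact: phiV.
  rewrite map1 => cx; apply: (subvP V1V); apply: (basis_mem bas1).
  by apply/flattenP; exists c.
pose E : seq U := vbasis (V :\: <<B1>>).
pose cs := map (chain_forms \1%VF phi) cs1 ++ [seq [:: e] | e <- E].
have flat_cs : flatten cs = B1 ++ E.
  by rewrite flatten_cat; congr (_ ++ _); elim: (E) => //= e s ->.
have basV : basis_of V (flatten cs).
  rewrite flat_cs; have -> : V = (<<B1>> + (V :\: <<B1>>))%VS.
    by rewrite addvC addv_diff; apply/esym/addv_idPl.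
  apply: cat_basis (vbasisP _); last by rewrite /basis_of free1 eqxx.
  by apply/directv_addP; rewrite capvC capv_diff.
have nzcs : all (fun c => c != [::]) cs.
  rewrite all_cat !all_map; apply/andP; split; last by apply/allP.
  by apply/allP => c _ /=; rewrite -size_eq0 size_rcons.
have linkcs c : c \in cs -> links al be c.
  rewrite mem_cat => /orP[/mapP[c1 cs1c1 ->]|/mapP[e _ ->]]; last by [].
  rewrite /chain_forms map1 => j; rewrite size_rcons ltnS => ltj.
  have c1V1 i : (i < size c1)%N -> c1`_i \in V1.
    move=> lti; apply: (basis_mem bas1); apply/flattenP; exists c1 => //.
    exact: mem_nth.
  rewrite !nth_rcons ltj; rewrite -alphi ?c1V1 //; congr (al _).
  have [lt|] := ltnP j.+1 (size c1); first by rewrite link1 // id_lfunE.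
  move=> le; have eqj : j.+1 = size c1 by apply/eqP; rewrite eqn_leq ltj le.
  by rewrite -eqj eqxx -nth_last -eqj.
exists cs; split => //.
have freeB := basis_free basV.
pose lasts := map (last 0) cs.
have lastV : (<<lasts>> <= V)%VS.
  apply/span_subvP => x /mapP[c csc ->]; apply: (basis_mem basV).
  apply/flattenP; exists c => //; have := allP nzcs c csc.
  by case: c {csc} => //= y c _; apply: mem_last.
have perm_cs : perm_eq (flatten cs) (flatten cs1 ++ lasts).
  rewrite flat_cs /lasts map_cat catA; apply: perm_cat.
    apply: (perm_trans (perm_flatten_rcons _ _ _)).
    have -> : [seq map \1%VF i | i <- cs1] = cs1.
      by rewrite -[RHS]map_id; apply: eq_map => c; rewrite map1.
    rewrite perm_cat2l -map_comp; set l1 := map _ _; set l2 := map _ _.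
    suff -> : l1 = l2 by [].
    by apply: eq_map => c; rewrite /= /chain_forms last_rcons.
  by rewrite -map_comp /= map_id.
have free_lasts : free lasts.
  by apply: (catr_free (X := flatten cs1)); rewrite -(perm_free perm_cs).
have cap_lasts : (V1 :&: <<lasts>> = 0)%VS.
  rewrite -(span_basis bas1); apply/directv_addP.
  by move: freeB; rewrite (perm_free perm_cs) cat_free => /and3P[].
rewrite (perm_free (perm_flatten_rcons _ _ _)) cat_free; apply/and3P; split.
- rewrite -map_flatten; have := limg_basis_of (kerI _ injal) basV; exact: basis_free.
- rewrite (map_comp be (last 0)); apply: basis_free.
  apply: (limg_basis_of (U := <<lasts>>)); last by rewrite /basis_of free_lasts eqxx.
  apply/eqP; rewrite -subv0 -(kerI _ injbe); exact: capvS lastV (subvv _).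
(* The last vectors of the new chains span a complement of [V1]. If [u] in their span has [be u] in
   al V, then [u] lies in [V1], so it is zero. *)
- apply/directv_addP; apply/eqP; rewrite -subv0; apply/subvP => w.
  rewrite -map_flatten (map_comp be (last 0)) -!limg_span memv_cap.
  case/andP=> alw /memv_imgP[u lu wE]; rewrite wE.
  have : u \in (V1 :&: <<lasts>>)%VS.
    rewrite memv_cap lu andbT memv_cap (subvP lastV) //= -memv_preim -wE.
    by rewrite -(span_basis basV).
  by rewrite cap_lasts !memv0 => /eqP->; rewrite linear0.
Qed.

End Pencils.

(** * The coordinate ring of a scroll *)

Lemma base_digits_inj (n B : nat) (a b : 'I_n -> nat) :
  (forall i, a i < B)%N -> (forall i, b i < B)%N ->
  (\sum_(i < n) a i * B ^ i = \sum_(i < n) b i * B ^ i)%N -> a =1 b.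
Proof.
elim: n a b => [|n IH] a b ltaB ltbB; first by move=> _ [].
rewrite !big_ord_recl /= expn0 !muln1.
have shift (c : 'I_n.+1 -> nat) : (\sum_(i < n) c (lift ord0 i) * B ^ bump 0 i
    = (\sum_(i < n) c (lift ord0 i) * B ^ i) * B)%N.
  rewrite big_distrl; apply: eq_bigr => i _.
  by rewrite /bump /= add1n expnSr mulnA.
rewrite !shift => eq_ab.
have eq0 : a ord0 = b ord0.
  have /(congr1 (modn^~ B)) := eq_ab.
  by rewrite /= ![(_ + _ * B)%N]addnC !modnMDl !modn_small.
have Bgt0 : (0 < B)%N by apply: leq_ltn_trans (ltaB ord0).
move: eq_ab; rewrite eq0 => /addnI/eqP; rewrite eqn_pmul2r // => /eqP/IH eqL.
move=> i; case: (unliftP ord0 i) => [j|] -> //.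
by apply: eqL.
Qed.

Section MpolyVanish.
Variable k : closedFieldType.

(** Kronecker substitution: sending the i-th variable to x^(B^i), with [B] above every exponent,
    keeps the monomials of [f] distinct and reduces the claim to one variable. *)
Lemma mpoly_ext0 n (f : {mpoly k[n]}) : (forall v, f.@[v] = 0) -> f = 0.
Proof.
move=> f0; pose B := msize f.
pose enc (a : 'X_{1..n}) := (\sum_(i < n) a i * B ^ i)%N.
have encI a b : a \in msupp f -> b \in msupp f -> enc a = enc b -> a = b.
  have ltB c i : c \in msupp f -> (c i < B)%N.
    move=> /msize_mdeg_lt; apply: leq_ltn_trans; rewrite mdegE.
    by rewrite (bigD1 i) //= leq_addr.
  by move=> af bf eqab; apply/mnmP; apply: (base_digits_inj _ _ eqab) => i; apply: ltB.
pose P : {poly k} := \sum_(a <- msupp f) f@_a *: 'X^(enc a).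
have P0 : P = 0.
  apply: poly_ext0 => x; rewrite /P horner_sum.
  rewrite -[RHS](f0 (fun i => x ^+ (B ^ i)%N)) mevalE; apply: eq_bigr => a _.
  rewrite hornerZ hornerXn; congr (_ * _); rewrite /enc -prodrXr.
  by apply: eq_bigr => i _; rewrite -exprM mulnC.
apply/mpolyP => a; rewrite mcoeff0; apply/eqP; rewrite mcoeff_eq0; apply/negP => af.
have : P`_(enc a) = f@_a.
  rewrite /P coef_sum (bigD1_seq a) //= ?msupp_uniq // coefZ coefXn eqxx mulr1.
  rewrite big_seq_cond big1 ?addr0 // => b /andP[bf ne_ba].
  rewrite coefZ coefXn; case: eqP => [eq_e|]; last by rewrite mulr0.
  by rewrite (encI _ _ af bf eq_e) eqxx in ne_ba.
by rewrite P0 coef0 => /esym/eqP; rewrite mcoeff_eq0 af.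
Qed.

End MpolyVanish.

Lemma perm_map_lift (T : eqType) (U : eqType) (f : T -> U) (s t : seq T) :
  perm_eq (map f s) (map f t) -> exists2 u, perm_eq u t & map f s = map f u.
Proof.
case: t => [|x0 t]; first by case: s => [|y s] /perm_size //; exists [::].
move=> /(perm_iotaP (f x0))[Is permI eqf]; rewrite size_map in permI.
exists (map (nth x0 (x0 :: t)) Is).
  have := perm_map (nth x0 (x0 :: t)) permI.
  by rewrite -/(mkseq _ _) mkseq_nth.
rewrite eqf -map_comp; apply/eq_in_map => i; rewrite (perm_mem permI) mem_iota => /andP[_ lti].
by rewrite (nth_map x0).
Qed.

Section Blocks.
(* [e j] says that the interval of indices is cut after [j]. *)
Variable e : pred nat.

Definition blk (j : nat) := count e (iota 0 j).

Lemma blkS j : blk j.+1 = (blk j + e j)%N.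
Proof. by rewrite /blk -addn1 iotaD count_cat /= addn0. Qed.

Lemma blk_mono i j : (i <= j)%N -> (blk i <= blk j)%N.
Proof. by move=> /subnK <-; rewrite addnC /blk iotaD count_cat leq_addr. Qed.

Lemma blk_same i j : (i < j)%N -> blk i = blk j -> ~~ e i.
Proof.
move=> lt_ij eq_ij; have := blk_mono lt_ij; rewrite -eq_ij blkS.
by case: (e i); rewrite ?addn1 ?ltnn.
Qed.

Lemma blk_same_pred i j : (i < j)%N -> blk i = blk j -> ~~ e j.-1.
Proof.
case: j => // j; rewrite ltnS => le_ij eq_ij.
have := blk_mono le_ij; rewrite eq_ij blkS /=.
by case: (e j); rewrite ?addn1 ?ltnn.
Qed.

(** An entry exceeding its counterpart in the same block is not the first index of that block, so it
    can be lowered by one within the block. It is the donor of a unit transfer in [straighten]. *)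
Lemma larger_entry v v' : map blk v = map blk v' -> (sumn v' < sumn v)%N ->
  exists v1 j v2, [/\ v = v1 ++ j :: v2, (0 < j)%N & ~~ e j.-1].
Proof.
elim: v v' => [|i v IH] [|i' v'] //= [eqi eqv] ltv.
have [lti|gei] := ltnP i' i.
  exists [::], i, v; split=> //; first by apply: leq_ltn_trans lti.
  exact: blk_same_pred lti (esym eqi).
have /(IH _ eqv)[v1 [j [v2 [-> j0 ej]]]] : (sumn v' < sumn v)%N by lia.
by exists (i :: v1), j, v2.
Qed.

End Blocks.

Section ScrollRing.
Variables (k : closedFieldType) (s : nat) (e : pred nat).
Notation S := {mpoly k[s.+1]}.
Notation q := (blk e s).+1.

Definition cols := [seq j <- iota 0 s | ~~ e j].

Definition minors (L : 'I_s.+1 -> S) : seq S :=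
  [seq L (inord p.1) * L (inord p.2.+1) - L (inord p.2) * L (inord p.1.+1)
    | p <- [seq (j, j') | j <- cols, j' <- cols] & (p.1 < p.2)%N].

Let x (j : nat) : S := 'X_(inord j).
Let I : S -> Prop := gen_ideal (minors (fun i => 'X_i)).
Let iI : ideal I := gen_ideal_ideal _.

Lemma cols_minor j j' : j \in cols -> j' \in cols -> I (x j * x j'.+1 - x j' * x j.+1).
Proof.
have lt_case i i' : i \in cols -> i' \in cols -> (i < i')%N ->
    I (x i * x i'.+1 - x i' * x i.+1).
  move=> ci ci' lti; apply: gen_ideal_mem; apply/mapP; exists (i, i') => //.
  by rewrite mem_filter lti; apply/allpairsP; exists (i, i').
move=> cj cj'; case: (ltngtP j j') => [lt|gt|->]; first exact: lt_case.
  by have := lt_case _ _ cj' cj gt; rewrite -opprB => /(idealN iI); rewrite opprK.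
by rewrite subrr; apply: ideal0.
Qed.

Lemma mem_cols j : (j \in cols) = ~~ e j && (j < s)%N.
Proof. by rewrite mem_filter mem_iota. Qed.

(* Two such monomials are connected by unit transfers between factors, that is
   by relations x_i x_j = x_(i+1) x_(j-1). *)
Lemma straighten w w' : all (leq^~ s) w -> all (leq^~ s) w' ->
  map (blk e) w = map (blk e) w' -> sumn w = sumn w' ->
  I (\prod_(i <- w) x i - \prod_(i <- w') x i).
Proof.
have [n] := ubnP (size w); elim: n w w' => // n IH [|i v] [|i' v'] //=.
  by rewrite subrr => *; apply: ideal0.
rewrite ltnS; wlog le_ii' : i i' v v' / (i <= i')%N.
  move=> W szv aw aw' eqb eqs; have [le|/ltnW le] := leqP i i'; first exact: W.
  apply: ideal_subC => //; apply: W => //.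
  by case: eqb => _ /(congr1 size); rewrite !size_map => <-.
have [d] := ubnP (i' - i); elim: d i v le_ii' => // d IHd i v le_ii' ltd szv.
move=> /andP[lis av] /andP[lis' av'] [eqi eqv] eqs.
have [eq_ii'|ne_ii'] := eqVneq i i'.
  rewrite eq_ii' !big_cons -mulrBr; apply: idealMl => //; apply: IH => //.
  by move: eqs; rewrite eq_ii' => /addnI.
have lt_ii' : (i < i')%N by rewrite ltn_neqAle ne_ii'.
have ei : ~~ e i := blk_same lt_ii' eqi.
(* As [i] is less than [i'] and the sums agree, the tail can donate a unit: raising [i] and lowering
   [j] is one minor and decreases i' - i. *)
have [|v1 [j [v2 [v_def j0 ej]]]] := larger_entry eqv; first by lia.
have js : (j <= s)%N by move: av; rewrite v_def all_cat /= => /and3P[].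
have ci : i \in cols by rewrite mem_cols ei (leq_trans lt_ii').
have cj : j.-1 \in cols by rewrite mem_cols ej prednK.
apply: (@ideal_sub_trans _ _ _ _ (\prod_(t <- i.+1 :: v1 ++ j.-1 :: v2) x t)) => //.
  rewrite v_def !big_cons !big_cat !big_cons /=.
  have := idealMl (\prod_(t <- v1) x t * \prod_(t <- v2) x t) iI (cols_minor ci cj).
  rewrite prednK //; congr I; ring.
apply: IHd => //; first by lia.
- by move: szv; rewrite v_def !size_cat.
- move: av; rewrite v_def !all_cat /= (leq_trans lt_ii') // => /and3P[-> _ ->].
  by rewrite (leq_trans (leq_pred j)).
- by rewrite lis' av'.
- rewrite blkS (negPf ei) addn0 eqi -eqv v_def !map_cat /=; congr (_ :: _ ++ _ :: _).
  by rewrite -[in RHS](prednK j0) blkS (negPf ej) addn0.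
- by move: eqs; rewrite v_def !sumn_cat /=; lia.
Qed.

(* The monomial map x_j |-> u_(blk j) t^j onto the coordinate ring of the scroll;
   the last variable is t. *)
Definition index_weight (j : nat) : 'X_{1..q.+1} :=
  (U_(inord (blk e j)) + U_(ord_max) *+ j)%MM.

Definition param : {rmorphism S -> {mpoly k[q.+1]}} :=
  comp_mpoly [tuple 'X_[index_weight i] | i < s.+1].

Lemma paramX (i : 'I_s.+1) : param 'X_i = 'X_[index_weight i].
Proof. by rewrite /param /= comp_mpolyXU -tnth_nth tnth_mktuple. Qed.

Lemma paramZ c f : param (c *: f) = c *: param f.
Proof. exact: comp_mpolyZ. Qed.

Definition mclass (m : 'X_{1..s.+1}) : 'X_{1..q.+1} :=
  (\sum_(i < s.+1) index_weight i *+ m i)%MM.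

Lemma param_mon m : param 'X_[m] = 'X_[mclass m].
Proof.
rewrite /param /= comp_mpolyX /mclass -mprodXnE; apply: eq_bigr => i _.
by rewrite tnth_mktuple.
Qed.

Lemma mcoeff_param f a : (param f)@_a = \sum_(m <- msupp f) f@_m * (mclass m == a)%:R.
Proof.
rewrite {1}[f]mpolyE rmorph_sum (raddf_sum (mcoeff a)); apply: eq_bigr => m _.
by rewrite -[LHS]/((param _)@_a) paramZ param_mon mcoeffZ mcoeffX.
Qed.

Definition word (m : 'X_{1..s.+1}) : seq nat :=
  flatten [seq nseq (m i) (val i) | i <- enum 'I_s.+1].

Lemma big_word (T : Type) (idx : T) (op : Monoid.com_law idx) (F : nat -> T) m :
  \big[op/idx]_(j <- word m) F j = \big[op/idx]_(i < s.+1) iter (m i) (op (F i)) idx.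
Proof.
rewrite /word big_flatten big_map big_enum; apply: eq_bigr => i _.
by rewrite big_nseq.
Qed.

Lemma all_word m : all (leq^~ s) (word m).
Proof.
apply/allP => j /flatten_mapP[i _]; rewrite mem_nseq => /andP[_ /eqP->].
by rewrite -ltnS ltn_ord.
Qed.

Lemma prod_word m : \prod_(j <- word m) x j = 'X_[m].
Proof.
rewrite big_word mpolyXE_id; apply: eq_bigr => i _.
by rewrite iter_mulr_1 /x inord_val.
Qed.

Lemma sum_word (F : nat -> nat) m : (\sum_(j <- word m) F j = \sum_(i < s.+1) F i * m i)%N.
Proof. by rewrite big_word; apply: eq_bigr => i _; rewrite iter_addn_0. Qed.

Lemma blk_lt j : (j <= s)%N -> (blk e j < q)%N.
Proof. by move=> js; rewrite ltnS blk_mono. Qed.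

Lemma index_weight_last j : (j <= s)%N -> index_weight j ord_max = j.
Proof.
move=> js; rewrite mnmDE mulmnE !mnm1E eqxx mul1n.
suff /negPf-> : inord (blk e j) != ord_max :> 'I_q.+1 by [].
by rewrite -val_eqE /= inordK ?neq_ltn ?blk_lt // ltnW // ltnS blk_lt.
Qed.

Lemma index_weight_blk j b : (j <= s)%N -> (b < q)%N -> index_weight j (inord b) = (blk e j == b).
Proof.
move=> js bq; rewrite mnmDE mulmnE !mnm1E.
have inordv c : (c < q)%N -> (inord c : 'I_q.+1) = c :> nat.
  by move=> cq; rewrite inordK // ltnW // ltnS.
rewrite -!val_eqE /= !inordv ?blk_lt //.
by rewrite (gtn_eqF bq) mul0n addn0.
Qed.

Lemma mclass_last m : mclass m ord_max = sumn (word m).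
Proof.
rewrite sumnE sum_word mnm_sumE; apply: eq_bigr => i _.
by rewrite mulmnE index_weight_last // -ltnS.
Qed.

Lemma mclass_blk m b : (b < q)%N -> mclass m (inord b) = count_mem b (map (blk e) (word m)).
Proof.
move=> bq; rewrite -sum1_count big_map big_mkcond /= sum_word mnm_sumE.
by apply: eq_bigr => i _; rewrite mulmnE index_weight_blk // -ltnS.
Qed.

(** Equal classes mean equal numbers of factors in each block and equal index sums; permuting one
    word makes the blocks agree position by position, as [straighten] requires. *)
Lemma monomial_congr m m' : mclass m = mclass m' -> I ('X_[m] - 'X_[m']).
Proof.
move=> eq_cl; rewrite -!prod_word.
have /perm_map_lift[u perm_u eq_u] :
    perm_eq (map (blk e) (word m)) (map (blk e) (word m')).
  apply/allP => b; rewrite mem_cat => bm /=.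
  have bq : (b < q)%N.
    by case/orP: bm => /mapP[j /(allP (all_word _)) js ->]; apply: blk_lt.
  by rewrite -!mclass_blk // eq_cl.
rewrite -(perm_big _ perm_u); apply: straighten => //; first exact: all_word.
  by rewrite (perm_all _ perm_u) all_word.
by rewrite (perm_sumn perm_u) -!mclass_last eq_cl.
Qed.

(** The terms of [f] are grouped by class. The coefficients of one class add up to a coefficient of
    [param f], which is zero, so each group is a combination of differences of congruent
    monomials. *)
Lemma param_ker f : param f = 0 -> I f.
Proof.
move=> pf0; rewrite [f]mpolyE; pose r := undup (map mclass (msupp f)).
have -> : \sum_(m <- msupp f) f@_m *: 'X_[m] = \sum_(a <- r) \sum_(m <- msupp f)
    (mclass m == a)%:R *: (f@_m *: 'X_[m]).
  rewrite exchange_big /= big_seq [RHS]big_seq; apply: eq_bigr => m mf.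
  have clr : mclass m \in r by rewrite mem_undup map_f.
  rewrite (bigD1_seq _ clr) ?undup_uniq //= eqxx scale1r big1 ?addr0 // => a.
  by rewrite eq_sym => /negPf->; rewrite scale0r.
rewrite big_seq; apply: ideal_sum => // a; rewrite mem_undup => /mapP[m0 _ ->].
have eq0 : \sum_(m <- msupp f) (mclass m == mclass m0)%:R *: (f@_m *: 'X_[m0]) = 0 :> S.
  under eq_bigr do rewrite scalerA mulrC.
  by rewrite -scaler_suml -mcoeff_param pf0 mcoeff0 scale0r.
rewrite -[X in I X]subr0 -[X in _ - X]eq0 -sumrB; apply: ideal_sum => // m _.
rewrite -!scalerBr; case: eqP => [eq_cl|_]; last by rewrite scale0r; apply: ideal0.
by do 2!apply: idealZ => //; apply: monomial_congr.
Qed.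

Lemma param_x j : (j <= s)%N -> param (x j) = 'X_[index_weight j].
Proof. by move=> js; rewrite paramX inordK. Qed.

Lemma index_weightS j : j \in cols -> index_weight j.+1 = (index_weight j + U_(ord_max))%MM.
Proof.
by rewrite mem_cols => /andP[/negPf ej js]; rewrite /index_weight blkS ej addn0 mulmSr addmA.
Qed.

Lemma param_step j : j \in cols -> param (x j.+1) = 'X_ord_max * param (x j).
Proof.
move=> cj; have /andP[_ js] : ~~ e j && (j < s)%N by rewrite -mem_cols.
by rewrite !param_x ?(ltnW js) // index_weightS // mpolyXD mulrC.
Qed.

Lemma param_minors g : g \in minors (fun i => 'X_i) -> param g = 0.
Proof.
case/mapP=> -[j j']; rewrite mem_filter => /andP[_ /allpairsP[[i i'] [/= ci ci' [-> ->]]]] ->.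
rewrite /= rmorphB !rmorphM -!/(x _) !param_step //; ring.
Qed.

Lemma paramP f : I f <-> param f = 0.
Proof.
split=> [|/param_ker//]; apply: (gen_ideal_min (I := fun f => param f = 0)).
  split=> [|f1 f2 f10 f20|f1 f2 f20]; first exact: rmorph0.
    by rewrite rmorphD f10 f20 addr0.
  by rewrite rmorphM f20 mulr0.
exact: param_minors.
Qed.

(** Points in the image of the monomial parametrization lie on the scroll, so for [f] vanishing
    there [param f] vanishes everywhere and is zero. *)
Lemma scroll_vanishing f :
  vanishing (zero_set (minors (fun i => 'X_i))) f <-> I f.
Proof.
split=> [If|If v Cv]; last first.
  suff : vanishing (eq v) f by apply.
  apply: gen_ideal_min If; first exact: vanishing_ideal.
  by move=> g gm _ <-; apply: Cv.
apply: param_ker; apply: mpoly_ext0 => v.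
have parE g : (param g).@[v] = g.@[fun i : 'I_s.+1 => 'X_[index_weight i].@[v]].
  by rewrite comp_mpoly_meval; apply: meval_eq => i; rewrite tnth_mktuple.
by rewrite parE; apply: If => g gm; rewrite -parE param_minors // meval0.
Qed.

End ScrollRing.

(** * The Hilbert polynomial of a scroll *)

Section HilbertPolynomial.

Fixpoint bin_poly (m : nat) : {poly rat} :=
  if m is m'.+1 then (m'.+1%:R)^-1 *: (bin_poly m' * ('X + (m'.+1%:R)%:P)) else 1.

Lemma bin_polyE m d : (bin_poly m).[d%:R] = 'C(m + d, m)%:R.
Proof.
elim: m => [|m IH]; first by rewrite hornerC bin0.
rewrite hornerZ hornerM IH hornerD hornerX hornerC.
apply: (mulfI (x := m.+1%:R)); first by rewrite pnatr_eq0.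
rewrite mulrA mulfV ?pnatr_eq0 // mul1r -natrD -!natrM; congr _%:R.
by rewrite -mul_bin_diag mulnC addSn addnS [in LHS](addnC d).
Qed.

Lemma size_bin_poly m : size (bin_poly m) = m.+1.
Proof.
elim: m => [|m IH]; first by rewrite size_poly1.
rewrite size_scale ?invr_eq0 ?pnatr_eq0 // size_Mmonic ?monicXaddC //.
  by rewrite size_XaddC IH addnC.
by rewrite -size_poly_eq0 IH.
Qed.

Lemma lead_coef_bin_poly m : lead_coef (bin_poly m) = (m`!%:R)^-1.
Proof.
elim: m => [|m IH]; first by rewrite lead_coef1 invr1.
rewrite lead_coefZ lead_coef_Mmonic ?monicXaddC // IH.
by rewrite factS natrM invfM.
Qed.

(* The Hilbert polynomial of a scroll with [q] blocks (vertex variables count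
   as blocks) whose matrix has [c] columns. *)
Definition scroll_poly (q c : nat) : {poly rat} :=
  bin_poly q.-1 * ((c%:R / q%:R) *: 'X + 1).

Lemma size_scroll_poly q c : (0 < q)%N -> (0 < c)%N -> size (scroll_poly q c) = q.+1.
Proof.
move=> q0 c0; have nz : c%:R / q%:R != 0 :> rat.
  by rewrite mulf_neq0 ?invr_eq0 ?pnatr_eq0 -?lt0n.
have sz : size ((c%:R / q%:R) *: 'X + 1 : {poly rat}) = 2.
  by rewrite size_addl size_scale ?size_polyX ?size_poly1.
rewrite size_mul -?size_poly_eq0 ?sz ?size_bin_poly //.
by rewrite prednK // addn2.
Qed.

Lemma lead_coef_scroll_poly q c : (0 < q)%N -> (0 < c)%N ->
  lead_coef (scroll_poly q c) * q`!%:R = c%:R.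
Proof.
move=> q0 c0; have nz : c%:R / q%:R != 0 :> rat.
  by rewrite mulf_neq0 ?invr_eq0 ?pnatr_eq0 -?lt0n.
rewrite lead_coefM lead_coef_bin_poly lead_coefDl ?size_scale ?size_polyX ?size_poly1 //.
rewrite lead_coefZ lead_coefX mulr1.
case: q q0 nz => // q _ _ /=; rewrite factS natrM.
have f0 : q`!%:R != 0 :> rat by rewrite pnatr_eq0 -lt0n fact_gt0.
have q0 : q.+1%:R != 0 :> rat by rewrite pnatr_eq0.
by field; rewrite nat1r q0 f0.
Qed.

(** With the block widths as weights, each summand counts the monomial classes having [tnth t i]
    factors in block [i]. Swapping coordinates shows that all coordinates have the same total over
    the tuples, so only the sum of the weights matters; hence the Hilbert function of a scroll
    depends only on its numbers of blocks and columns. *)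
Lemma sum_partition_weights (m d : nat) (w : 'I_m.+1 -> nat) :
  (m.+1 * \sum_(t : m.+1.-tuple 'I_d.+1 | \sum_(i <- t) i == d) (1 + \sum_i w i * tnth t i)
   = 'C(m + d, m) * (m.+1 + d * \sum_i w i))%N.
Proof.
pose P (t : m.+1.-tuple 'I_d.+1) := (\sum_(i <- t) i == d)%N.
pose Z (i : 'I_m.+1) := (\sum_(t | P t) tnth t i)%N.
have cardP : (\sum_(t | P t) 1 = 'C(m + d, m))%N.
  by rewrite sum1_card -card_ord_partitions cardsE.
have Zsym i : Z i = Z ord0.
  pose sw (t : m.+1.-tuple 'I_d.+1) := [tuple tnth t (tperm ord0 i j) | j < m.+1].
  have swK : involutive sw.
    by move=> t; apply: eq_from_tnth => j; rewrite !tnth_mktuple tpermK.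
  rewrite /Z (reindex_inj (inv_inj swK)) /=; apply: eq_big => [t|t _]; last first.
    by rewrite tnth_mktuple tpermR.
  rewrite /P !big_tuple (reindex_inj (@perm_inj _ (tperm ord0 i))) /=.
  by congr (_ == _); apply: eq_bigr => j _; rewrite tnth_mktuple tpermK.
have sumZ : (m.+1 * Z ord0 = d * 'C(m + d, m))%N.
  transitivity (\sum_(i < m.+1) Z i)%N.
    by under eq_bigr do rewrite Zsym; rewrite sum_nat_const card_ord.
  rewrite -cardP /Z exchange_big big_distrr /=; apply: eq_bigr => t /eqP tP.
  by rewrite muln1 -[RHS]tP big_tuple.
have sumwZ : (\sum_(t | P t) \sum_i w i * tnth t i = (\sum_i w i) * Z ord0)%N.
  rewrite exchange_big big_distrl; apply: eq_bigr => i _.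
  by rewrite -(Zsym i) /Z big_distrr.
rewrite big_split /= -/P cardP sumwZ mulnDr [in LHS]mulnCA sumZ; ring.
Qed.

End HilbertPolynomial.

Lemma count_downward (P : pred nat) n j :
  (forall i i', i <= i' -> P i' -> P i)%N -> (j < n)%N ->
  P j = (j < count P (iota 0 n))%N.
Proof.
move=> downP; elim: n => // n IH; rewrite ltnS => le_jn.
have -> : iota 0 n.+1 = iota 0 n ++ [:: n] by rewrite -addn1 iotaD.
rewrite count_cat /= addn0.
case Pn : (P n).
  have /eqP-> : count P (iota 0 n) == n.
    rewrite -[X in _ == X](size_iota 0) -all_count; apply/allP => i.
    by rewrite mem_iota => /andP[_ lti]; apply: downP Pn; apply: ltnW.
  by rewrite addn1 ltnS le_jn; apply: downP Pn.
rewrite addn0; have [lt_jn|] := ltnP j n; first exact: IH.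
move=> le_nj; have -> : j = n by apply/eqP; rewrite eqn_leq le_jn.
by rewrite Pn ltnNge -[X in (_ <= X)%N](size_iota 0) count_size.
Qed.

Lemma card_ord_le (M c : nat) : (c < M)%N -> #|[pred x : 'I_M | (x <= c)%N]| = c.+1.
Proof.
move=> lt_cM; have widenI : injective (widen_ord lt_cM).
  by move=> x y /(congr1 val)/= ?; apply: val_inj.
rewrite -[RHS]card_ord -(card_image widenI).
apply: eq_card => x; apply/idP/imageP => [xc|[y _ ->]]; last by rewrite inE -ltnS; exact: (ltn_ord y).
by exists (Ordinal (xc : (x < c.+1)%N)) => //; apply: val_inj.
Qed.

Section BlockIntervals.
Variables (s : nat) (e : pred nat).
Notation q := (blk e s).+1.

Definition start (b : nat) := count (fun j => blk e j < b)%N (iota 0 s.+1).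
(** One less than the number of indices in the block, that is, the number of columns it
    contributes. *)
Definition width (b : nat) := (count (fun j => blk e j == b) (iota 0 s.+1)).-1.

Lemma lt_start b j : (j <= s)%N -> (blk e j < b)%N = (j < start b)%N.
Proof.
move=> js; apply: (@count_downward (fun j => blk e j < b)%N) => // i i' le_ii'.
by apply: leq_ltn_trans; apply: blk_mono.
Qed.

Lemma start_le b : (b < q)%N -> (start b <= s)%N.
Proof. by rewrite ltnS leqNgt lt_start // -leqNgt. Qed.

Lemma startS b : (b < q)%N -> start b.+1 = (start b + (width b).+1)%N.
Proof.
move=> bq.
have stE : start b.+1 = (start b + count (fun j => blk e j == b) (iota 0 s.+1))%N.
  rewrite /start -count_predUI [X in (_ + X)%N](_ : _ = 0%N) ?addn0.
    by apply: eq_count => j /=; rewrite ltnS leq_eqVlt orbC.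
  rewrite -[RHS](count_pred0 (iota 0 s.+1)); apply: eq_count => j /=.
  by case: eqP => [->|]; rewrite ?ltnn ?andbF.
rewrite stE; congr (_ + _)%N; rewrite prednK // -(ltn_add2l (start b)) addn0 -stE.
rewrite -lt_start ?start_le // ltnS.
case def_j : (start b) => [|j] //; rewrite blkS.
have : (blk e j < b)%N.
  by rewrite lt_start ?def_j // ltnW // -def_j start_le.
by case: (e j); rewrite ?addn0 ?addn1 // => /ltnW.
Qed.

Lemma blk_eq_interval b j : (b < q)%N -> (j <= s)%N ->
  (blk e j == b) = (start b <= j <= start b + width b)%N.
Proof.
move=> bq js; rewrite -[(j <= _ + _)%N]ltnS -addnS -startS // -lt_start //.
by rewrite leqNgt -lt_start // -leqNgt ltnS eqn_leq andbC.
Qed.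

Lemma interval_le b : (b < q)%N -> (start b + width b <= s)%N.
Proof.
move=> bq; rewrite -ltnS -addnS -startS //.
by rewrite (leq_trans (count_size _ _)) // size_iota.
Qed.

Lemma sum_width : (\sum_(b < q) width b + q = s.+1)%N.
Proof.
have main n : (n <= q)%N -> (\sum_(b < n) width b + n = start n)%N.
  elim: n => [_|n IH ltn]; first by rewrite big_ord0 /start (eq_count (a2 := pred0)) ?count_pred0.
  rewrite big_ord_recr /= startS // -(IH (ltnW ltn)) !addnS.
  by rewrite addnAC.
rewrite main // /start; rewrite -[RHS](size_iota 0); apply/eqP; rewrite -all_count.
by apply/allP => j; rewrite mem_iota add0n ltnS => /andP[_ js]; rewrite ltnS blk_mono.
Qed.

Lemma size_cols : (size (cols s e) + q = s.+1)%N.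
Proof.
by rewrite size_filter addnS /blk addnC count_predC size_iota.
Qed.

Lemma sum_width_cols : (\sum_(b < q) width b = size (cols s e))%N.
Proof. by apply/eqP; rewrite -(eqn_add2r q) sum_width size_cols. Qed.

End BlockIntervals.

Section ScrollHilbert.
Variables (k : closedFieldType) (s : nat) (e : pred nat).
Notation S := {mpoly k[s.+1]}.
Notation q := (blk e s).+1.
Notation start := (start s e).
Notation width := (width s e).
Notation mclass := (@mclass s e).

Lemma mclassD (m m' : 'X_{1..s.+1}) : mclass (m + m')%MM = (mclass m + mclass m')%MM.
Proof.
apply/mnmP => i; rewrite mnmDE !mnm_sumE -big_split; apply: eq_bigr => j _.
by rewrite !mulmnE mnmDE mulnDr.
Qed.

Lemma mclassU (i : 'I_s.+1) : mclass U_(i)%MM = index_weight s e i.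
Proof.
apply/mnmP => a; rewrite mnm_sumE (bigD1 i) //= big1 ?addn0.
  by rewrite mulmnE mnm1E eqxx muln1.
by move=> j /negPf ne_ji; rewrite mulmnE mnm1E eq_sym ne_ji muln0.
Qed.

Lemma mclass0 : mclass 0%MM = 0%MM.
Proof. by apply/mnmP => a; rewrite mnm_sumE mnm0E big1 // => i _; rewrite mulmnE mnm0E muln0. Qed.

(** Greedy choice: the first factor absorbs as much of the excess [x] as the width of its block
    allows, and the remaining factors take the rest. *)
Lemma monomial_with_class (bl : seq nat) (x : nat) :
  all (fun b => b < q)%N bl -> (x <= \sum_(b <- bl) width b)%N ->
  exists m : 'X_{1..s.+1},
    [/\ mdeg m = size bl, mclass m ord_max = (x + \sum_(b <- bl) start b)%N
      & forall b, (b < q)%N -> mclass m (inord b) = count_mem b bl].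
Proof.
elim: bl x => [|b bl IH] x /=.
  rewrite big_nil leqn0 => _ /eqP->; exists 0%MM.
  by rewrite mdeg0 mclass0 mnm0E big_nil; split=> // b _; rewrite mnm0E.
case/andP=> bq blq; rewrite !big_cons => lex.
have [|m [degm lastm blkm]] := IH (x - minn x (width b))%N blq.
  by rewrite leq_subLR; case: (leqP x (width b)); lia.
set o := minn x (width b) in lastm *.
have le_o : (o <= width b)%N by apply: geq_minr.
have le_ox : (o <= x)%N by apply: geq_minl.
have js : (start b + o <= s)%N.
  by apply: leq_trans (interval_le bq); rewrite leq_add2l.
exists (U_(inord (start b + o)) + m)%MM.
rewrite mdegD mdeg1 degm mclassD mclassU inordK // add1n; split=> //.
  by rewrite mnmDE lastm index_weight_last //; lia.
move=> c cq; rewrite mnmDE blkm // index_weight_blk // eq_sym; congr (nat_of_bool _ + _)%N.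
have /eqP-> : blk e (start b + o) == b.
  by rewrite (blk_eq_interval bq js) leq_addr leq_add2l.
by rewrite eq_sym.
Qed.

Lemma mdeg_word (m : 'X_{1..s.+1}) : size (word m) = mdeg m.
Proof.
by rewrite -sum1_size sum_word mdegE; apply: eq_bigr => i _; rewrite mul1n.
Qed.

Lemma sum_by_block (F : nat -> nat) (w : seq nat) : all (leq^~ s) w ->
  (\sum_(j <- w) F (blk e j) = \sum_(b < q) F b * count_mem (val b) (map (blk e) w))%N.
Proof.
elim: w => [|j w IH] /=.
  by rewrite big_nil big1 // => b _; rewrite muln0.
case/andP=> js aw; rewrite big_cons IH //.
under [in RHS]eq_bigr do rewrite mulnDr.
rewrite big_split /=; congr (_ + _)%N.
rewrite (bigD1 (Ordinal (blk_lt e js))) //= eqxx muln1 big1 ?addn0 //.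
by move=> b /negPf; rewrite -val_eqE /= eq_sym => ->; rewrite muln0.
Qed.

(* A monomial class of degree [d] is determined by the number of factors in each
   block and by the excess of the sum of indices over its minimum. *)
Let weight d (t : q.-tuple 'I_d.+1) := (\sum_(b < q) width b * tnth t b)%N.
Let bound d := (s * d).+1.
Let K d := [pred p : q.-tuple 'I_d.+1 * 'I_(bound d) |
  (\sum_(b <- p.1) b == d)%N && (p.2 <= weight p.1)%N].
Let iota_cl d (p : q.-tuple 'I_d.+1 * 'I_(bound d)) : 'X_{1..q.+1} :=
  (\sum_(b < q) U_(inord b) *+ tnth p.1 b
    + U_(ord_max) *+ (p.2 + \sum_(b < q) start b * tnth p.1 b))%MM.

Let iota_last d p : @iota_cl d p ord_max = (p.2 + \sum_(b < q) start b * tnth p.1 b)%N.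
Proof.
rewrite mnmDE mulmnE mnm1E eqxx mul1n mnm_sumE big1 ?add0n // => b _.
rewrite mulmnE mnm1E; suff /negPf-> : inord b != ord_max :> 'I_q.+1 by [].
by rewrite -val_eqE /= inordK ?neq_ltn ?ltn_ord // ltnW // ltnS ltn_ord.
Qed.

Let iota_blk d p (b : 'I_q) : @iota_cl d p (inord b) = tnth p.1 b.
Proof.
have inordv (c : 'I_q) : (inord c : 'I_q.+1) = c :> nat.
  by rewrite inordK // ltnW // ltnS.
rewrite mnmDE mulmnE mnm1E -val_eqE /= inordv (gtn_eqF (ltn_ord b)) mul0n addn0.
rewrite mnm_sumE (bigD1 b) //= mulmnE mnm1E eqxx mul1n big1 ?addn0 // => c ne_cb.
by rewrite mulmnE mnm1E -val_eqE /= !inordv val_eqE (negPf ne_cb).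
Qed.

Let iota_inj d : injective (@iota_cl d).
Proof.
move=> [t x] [t' x'] eq_p; have eq_t : t = t'.
  apply: eq_from_tnth => b; apply: val_inj.
  by rewrite /= -(iota_blk (t, x)) eq_p iota_blk.
congr (_, _) => //; apply: val_inj; apply/eqP.
have := congr1 (fun a : 'X_{1..q.+1} => a ord_max) eq_p.
by rewrite !iota_last /= eq_t => /addIn/eqP.
Qed.

Let eq_cl (a a' : 'X_{1..q.+1}) : a ord_max = a' ord_max ->
  (forall b : 'I_q, a (inord b) = a' (inord b)) -> a = a'.
Proof.
move=> eq_last eq_blk; apply/mnmP => i; have [lt|ge] := ltnP i q.
  by have := eq_blk (Ordinal lt); rewrite /= inord_val.
suff -> : i = ord_max by []; apply/val_inj/eqP => /=.
by rewrite eqn_leq ge -ltnS ltn_ord.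
Qed.

Let weight_bound d (t : q.-tuple 'I_d.+1) :
  (\sum_(b <- t) b == d)%N -> (weight t < bound d)%N.
Proof.
move=> /eqP td; rewrite ltnS -[X in (_ <= _ * X)%N]td big_tuple big_distrr /=.
apply: leq_sum => b _; rewrite leq_mul2r; apply/orP; right.
by apply: leq_trans (interval_le (ltn_ord b)); rewrite leq_addl.
Qed.

Lemma card_classes d :
  (q * #|K d| = 'C(q.-1 + d, q.-1) * (q + size (cols s e) * d))%N.
Proof.
have -> : #|K d| = (\sum_(t : q.-tuple 'I_d.+1 | \sum_(b <- t) b == d) (1 + weight t))%N.
  rewrite -sum1_card.
  rewrite -(pair_big_dep (fun t : q.-tuple 'I_d.+1 => \sum_(b <- t) b == d)%N
             (fun t (x : 'I_(bound d)) => (x <= weight t)%N) (fun _ _ => 1%N)) /=.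
  apply: eq_bigr => t td; rewrite sum1_card add1n -(card_ord_le (weight_bound td)).
  by apply: eq_card.
by rewrite sum_partition_weights /= sum_width_cols mulnC [(d * _)%N]mulnC mulnC.
Qed.

(** The coefficients of [param f] at the classes in [K d] serve as coordinates: every monomial of
    degree [d] has its class there, and [monomial_with_class] realises each member of [K d] by a
    monomial. *)
Lemma scroll_hilb_fun d :
  hilb_fun (gen_ideal (minors e (fun i => 'X_i : S))) d #|K d|.
Proof.
pose en (i : 'I_#|K d|) := @iota_cl d (enum_val i).
pose Phi (f : S) : 'rV[k]_#|K d| := \row_i (param k s e f)@_(en i).
have Phi_lin : linear Phi.
  move=> c f g; apply/rowP => i; rewrite !mxE rmorphD mcoeffD.
  by rewrite paramZ mcoeffZ.
have ker f : homog_deg d f -> (gen_ideal (minors e (fun i => 'X_i : S)) f <-> Phi f = 0).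
  move=> homf; rewrite paramP; split=> [pf0|Phi0].
    by apply/rowP => i; rewrite !mxE pf0 mcoeff0.
  apply/mpolyP => a; rewrite mcoeff0.
  have [/hasP[m mf /eqP clm]|/hasPn nocl] := boolP (has (fun m => mclass m == a) (msupp f)); last first.
    rewrite mcoeff_param big_seq big1 // => m /nocl/negPf->; exact: mulr0.
  have degm : mdeg m = d by move/dhomogP: homf; apply.
  have aw := all_word m.
  have cnt_lt (b : 'I_q) : (count_mem (val b) (map (blk e) (word m)) < d.+1)%N.
    by rewrite ltnS -degm -mdeg_word -(size_map (blk e)) count_size.
  pose t := [tuple Ordinal (cnt_lt b) | b < q].
  have tE b : tnth t b = count_mem (val b) (map (blk e) (word m)) :> nat.
    by rewrite tnth_mktuple.
  have sumt : (\sum_(b <- t) b == d)%N.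
    rewrite big_tuple; apply/eqP; apply: etrans degm.
    rewrite -mdeg_word -sum1_size (sum_by_block (fun=> 1%N) aw).
    by apply: eq_bigr => b _; rewrite tE mul1n.
  have sumE (F : nat -> nat) : (\sum_(j <- word m) F (blk e j) = \sum_(b < q) F b * tnth t b)%N.
    by rewrite (sum_by_block F aw); apply: eq_bigr => b _; rewrite tE.
  have inI j : j \in word m -> (start (blk e j) <= j <= start (blk e j) + width (blk e j))%N.
    by move=> /(allP aw) js; rewrite -blk_eq_interval ?blk_lt.
  have le_st : (\sum_(b < q) start b * tnth t b <= sumn (word m))%N.
    rewrite -sumE sumnE !big_seq; apply: leq_sum => j /inI/andP[]//.
  pose x := (sumn (word m) - \sum_(b < q) start b * tnth t b)%N.
  have le_x : (x <= weight t)%N.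
    rewrite leq_subLR /weight -!sumE -big_split sumnE !big_seq.
    by apply: leq_sum => j /inI/andP[].
  have ltx : (x < bound d)%N by apply: leq_ltn_trans le_x (weight_bound sumt).
  pose p := (t, Ordinal ltx).
  have Kp : p \in K d by rewrite inE sumt.
  have -> : a = en (enum_rank_in Kp p).
    rewrite /en enum_rankK_in // -clm; apply: eq_cl => [|b].
      by rewrite iota_last /= subnK // mclass_last.
    by rewrite iota_blk tE mclass_blk.
  by move/rowP/(_ (enum_rank_in Kp p)): Phi0; rewrite !mxE.
apply: (hilb_fun_of_map Phi_lin ker) => i.
have := enum_valP i; rewrite inE; set p := enum_val i => /andP[sump lep].
pose bl := flatten [seq nseq (tnth p.1 b) (val b) | b <- enum 'I_q].
have sum_bl (F : nat -> nat) : (\sum_(b <- bl) F b = \sum_(b < q) F b * tnth p.1 b)%N.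
  rewrite /bl big_flatten big_map big_enum; apply: eq_bigr => b _.
  by rewrite big_nseq iter_addn_0.
have [||m [degm lastm blkm]] := @monomial_with_class bl p.2.
- apply/allP => b /flatten_mapP[c _]; rewrite mem_nseq => /andP[_ /eqP->]; exact: ltn_ord.
- by rewrite sum_bl.
have clm : mclass m = en i.
  apply: eq_cl => [|b]; first by rewrite iota_last lastm sum_bl.
  rewrite iota_blk blkm // -sum1_count big_mkcond /= sum_bl (bigD1 b) //= eqxx mul1n.
  by rewrite big1 ?addn0 // => c /negPf; rewrite -val_eqE /= => ->.
exists 'X_[m]; split.
  rewrite /homog_deg dhomogX; apply/eqP; apply: (etrans degm).
  rewrite -sum1_size sum_bl -[RHS](eqP sump) big_tuple.
  by apply: eq_bigr => b _; rewrite mul1n.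
apply/rowP => j; rewrite !mxE eqxx /= param_mon mcoeffX clm; congr (nat_of_bool _)%:R.
apply/eqP/eqP => [eq_en|->//]; apply/esym.
by apply: enum_val_inj; apply: iota_inj.
Qed.

Lemma scroll_hilb_poly :
  hilb_poly (gen_ideal (minors e (fun i => 'X_i : S))) (scroll_poly q (size (cols s e))).
Proof.
exists 0%N => d _; exists #|K d|; split; first exact: scroll_hilb_fun.
have q0 : q%:R != 0 :> rat by rewrite pnatr_eq0.
apply: (mulfI q0); rewrite -natrM card_classes /scroll_poly.
rewrite hornerM bin_polyE hornerD hornerZ hornerX hornerC natrM natrD natrM.
by field; rewrite nat1r.
Qed.

End ScrollHilbert.

(** * Linear coordinate changes *)

Section LinearForms.
Variable k : closedFieldType.

Lemma mpoly_ext n (f g : {mpoly k[n]}) : (forall v, f.@[v] = g.@[v]) -> f = g.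
Proof.
by move=> eq_fg; apply/eqP; rewrite -subr_eq0; apply/eqP/mpoly_ext0 => v; rewrite mevalB eq_fg subrr.
Qed.

Definition lform n (u : 'rV[k]_n) : {mpoly k[n]} := \sum_(j < n) u 0 j *: 'X_j.

Lemma lform_meval n (u : 'rV[k]_n) v : (lform u).@[v] = \sum_j u 0 j * v j.
Proof. by rewrite raddf_sum; apply: eq_bigr => j _; rewrite /= mevalZ mevalXU. Qed.

Lemma lform_homog n (u : 'rV[k]_n) : homog_deg 1 (lform u).
Proof. by apply: rpred_sum => j _; apply: rpredZ; rewrite dhomogX; apply/eqP/mdeg1. Qed.

Lemma homog1_lform n (f : {mpoly k[n]}) : homog_deg 1 f -> exists u, f = lform u.
Proof.
move=> /dhomogP hf; exists (\row_j f@_U_(j)); apply/mpolyP => m.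
have [mf|nmf] := boolP (mdeg m == 1%N).
  have /mdeg1P[i /eqP->] := mf; rewrite raddf_sum (bigD1 i) //= mcoeffZ mcoeffXU eqxx mulr1 mxE.
  by rewrite big1 ?addr0 // => j /negPf ne_ji; rewrite mcoeffZ mcoeffXU ne_ji mulr0.
rewrite memN_msupp_eq0; last by apply: contra nmf => /hf/= ->.
apply/esym/memN_msupp_eq0; apply: contra nmf => mf.
by have /dhomogP/(_ m mf)/= -> := lform_homog (\row_j f@_U_(j)).
Qed.

Definition subst p q (M : 'M[k]_(p, q)) : {rmorphism {mpoly k[p]} -> {mpoly k[q]}} :=
  comp_mpoly [tuple lform (row i M) | i < p].

Lemma substZ p q (M : 'M[k]_(p, q)) c f : subst M (c *: f) = c *: subst M f.
Proof. exact: comp_mpolyZ. Qed.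

Lemma subst_meval p q (M : 'M[k]_(p, q)) f v : (subst M f).@[v] = f.@[lapp M v].
Proof.
rewrite /= comp_mpoly_meval; apply: meval_eq => i.
by rewrite tnth_mktuple lform_meval; apply: eq_bigr => j _; rewrite mxE.
Qed.

Lemma lapp_mul p q r (M : 'M[k]_(p, q)) (N : 'M[k]_(q, r)) v :
  lapp M (lapp N v) =1 lapp (M *m N) v.
Proof.
move=> i; rewrite /lapp; under eq_bigr do rewrite mulr_sumr.
rewrite exchange_big; apply: eq_bigr => j _; rewrite mxE mulr_suml.
by apply: eq_bigr => l _; rewrite mulrA.
Qed.

Lemma lapp1 p v : lapp (1%:M : 'M[k]_p) v =1 v.
Proof.
move=> i; rewrite /lapp (bigD1 i) //= mxE eqxx mul1r big1 ?addr0 // => j.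
by rewrite mxE eq_sym => /negPf->; rewrite mul0r.
Qed.

Lemma subst_mul p q r (M : 'M[k]_(p, q)) (N : 'M[k]_(q, r)) f :
  subst N (subst M f) = subst (M *m N) f.
Proof.
by apply: mpoly_ext => v; rewrite !subst_meval; apply: meval_eq => i; rewrite lapp_mul.
Qed.

Lemma subst1 p f : subst (1%:M : 'M[k]_p) f = f.
Proof. by apply: mpoly_ext => v; rewrite subst_meval; apply: meval_eq; apply: lapp1. Qed.

Lemma subst_lform p q (M : 'M[k]_(p, q)) u : subst M (lform u) = lform (u *m M).
Proof.
apply: mpoly_ext => v; rewrite subst_meval !lform_meval.
have := lapp_mul u M v 0; rewrite /lapp => <-; apply: eq_bigr => j _; done.
Qed.

Lemma subst_homog p q (M : 'M[k]_(p, q)) d f : homog_deg d f -> homog_deg d (subst M f).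
Proof.
move=> /dhomogP hf; rewrite /homog_deg /= comp_mpolyEX big_seq; apply: rpred_sum => m mf.
apply: rpredZ; rewrite -(hf m mf) /= mdegE comp_mpolyX.
apply: (big_rec2 (fun (x : {mpoly k[q]}) y => x \is y.-homog)) => [|i a b _ hb].
  exact: dhomog1.
apply: dhomogM => //; rewrite tnth_mktuple.
by have := dhomogMn (m i) (lform_homog (row i M)); rewrite mul1n.
Qed.

Lemma lformX n (i : 'I_n) : lform (row i 1%:M) = 'X_i.
Proof.
rewrite /lform (bigD1 i) //= !mxE eqxx scale1r big1 ?addr0 // => j.
by rewrite !mxE eq_sym => /negPf->; rewrite scale0r.
Qed.

Lemma lformD n (u v : 'rV[k]_n) : lform (u + v) = lform u + lform v.
Proof. by rewrite -big_split; apply: eq_bigr => j _; rewrite mxE scalerDl. Qed.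

Lemma lformZ n c (u : 'rV[k]_n) : lform (c *: u) = c *: lform u.
Proof. by rewrite scaler_sumr; apply: eq_bigr => j _; rewrite mxE scalerA. Qed.

End LinearForms.

Lemma lin_indep_modP (k : closedFieldType) (m : nat) (I : {mpoly k[m]} -> Prop) fs : lin_indep_mod I fs <->
  forall c : nat -> k, I (\sum_(i < size fs) c i *: fs`_i) ->
    forall i, (i < size fs)%N -> c i = 0.
Proof.
split=> [ind c Ic i lti|ind c Ic i]; first exact: (ind (fun i => c i) Ic (Ordinal lti)).
pose c' j := if insub j is Some i then c i else 0.
have c'E (j : 'I_(size fs)) : c' j = c j by rewrite /c' valK.
by rewrite -c'E ind //; under eq_bigr do rewrite c'E.
Qed.

Lemma lin_indep_mod_map (k : closedFieldType) (m n : nat) (I : {mpoly k[m]} -> Prop) (J : {mpoly k[n]} -> Prop)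
    (phi : {mpoly k[n]} -> {mpoly k[m]}) fs :
  (forall f g, phi (f + g) = phi f + phi g) -> (forall c f, phi (c *: f) = c *: phi f) ->
  (forall f, J f <-> I (phi f)) -> lin_indep_mod J fs -> lin_indep_mod I (map phi fs).
Proof.
move=> phiD phiZ IJ /lin_indep_modP ind; apply/lin_indep_modP => c.
rewrite size_map => Ic; apply: ind; apply/IJ.
have phi0 : phi 0 = 0 by rewrite -(scale0r 0) phiZ scale0r.
rewrite (big_morph phi phiD phi0); move: Ic; congr I; apply: eq_bigr => i _.
by rewrite phiZ (nth_map 0).
Qed.

Lemma hilb_fun_subst (k : closedFieldType) m (A : 'M[k]_m) (I J : {mpoly k[m]} -> Prop) d h :
  A \in unitmx -> (forall f, J f <-> I (subst (invmx A) f)) ->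
  hilb_fun I d h -> hilb_fun J d h.
Proof.
move=> uA IJ [[fs [szfs [homfs indfs]]] maxfs].
have sAK f : subst (invmx A) (subst A f) = f by rewrite subst_mul mulmxV // subst1.
split.
  exists (map (subst A) fs); rewrite size_map; split=> //; split.
    by move=> f /mapP[g /homfs hg ->]; apply: subst_homog.
  apply: lin_indep_mod_map indfs => [f g|c f|f]; [exact: rmorphD|exact: substZ|].
  by rewrite IJ sAK.
move=> gs homgs indgs; rewrite -(size_map (subst (invmx A))); apply: maxfs.
  by move=> f /mapP[g /homgs hg ->]; apply: subst_homog.
apply: lin_indep_mod_map indgs => [f g|c f|f]; [exact: rmorphD|exact: substZ|].
by rewrite IJ.
Qed.

Section ScrollCone.
Variables (k : closedFieldType) (s : nat) (e : pred nat) (A : 'M[k]_s.+1).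
Hypothesis uA : A \in unitmx.
Variable C : ('I_s.+1 -> k) -> Prop.
Let L (i : 'I_s.+1) := lform (row i A).
Hypothesis CP : forall v, C v <-> zero_set (minors e L) v.
Notation X := (fun i : 'I_s.+1 => 'X_i : {mpoly k[s.+1]}).

Lemma minors_subst : minors e L = map (subst A) (minors e X).
Proof.
rewrite /minors -map_comp; apply: eq_map => -[j j'] /=.
have sX i : comp_mpoly [tuple lform (row i A) | i < s.+1] 'X_i = L i.
  by rewrite comp_mpolyXU -tnth_nth tnth_mktuple.
by rewrite rmorphB !rmorphM /= !sX.
Qed.

Lemma scroll_cone_point v : C v <-> zero_set (minors e X) (lapp A v).
Proof.
rewrite CP minors_subst; split=> zv g => [gm|/mapP[g' gm ->]].
  by rewrite -subst_meval; apply: zv; apply: map_f.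
by rewrite subst_meval; apply: zv.
Qed.

Definition scroll_param : {rmorphism {mpoly k[s.+1]} -> _} :=
  (param k s e \o subst (invmx A))%FUN.

Lemma scroll_paramE f : scroll_param f = param k s e (subst (invmx A) f).
Proof. by []. Qed.

Lemma scroll_param_vanishing f : vanishing C f <-> scroll_param f = 0.
Proof.
rewrite /scroll_param /= -paramP -scroll_vanishing; split=> vf v.
  move=> zv; rewrite subst_meval; apply: vf; apply/scroll_cone_point.
  have eqv : lapp A (lapp (invmx A) v) =1 v.
    by move=> i; rewrite lapp_mul mulmxV // lapp1.
  by move=> g gm; rewrite (meval_eq _ eqv); apply: zv.
move=> /scroll_cone_point zv; have := vf _ zv; rewrite subst_meval => <-.
by apply: meval_eq => i; rewrite lapp_mul mulVmx // lapp1.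
Qed.

Lemma scroll_ideal_vanishing f : vanishing C f <-> gen_ideal (minors e L) f.
Proof.
split; last first.
  by apply: (gen_ideal_min (vanishing_ideal C)) => g gm v /CP; apply.
move/scroll_param_vanishing => /paramP gf.
suff : gen_ideal (minors e L) (subst A (subst (invmx A) f)).
  by rewrite subst_mul mulVmx // subst1.
apply: (gen_ideal_min (I := fun g => gen_ideal (minors e L) (subst A g))) gf.
  split=> [|f1 f2|f1 f2]; rewrite ?rmorph0 ?rmorphD ?rmorphM.
  - exact: ideal0 (gen_ideal_ideal _).
  - exact: idealD (gen_ideal_ideal _).
  - exact: idealMl (gen_ideal_ideal _).
by move=> g gm; apply: gen_ideal_mem; rewrite minors_subst; apply: map_f.
Qed.

Lemma scroll_cone_hilb_poly :
  hilb_poly (vanishing C) (scroll_poly (blk e s).+1 (size (cols s e))).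
Proof.
have [d0 Hd0] := scroll_hilb_poly k s e; exists d0 => d /Hd0[h [Hh Ph]].
exists h; split=> //; apply: (hilb_fun_subst uA _ Hh) => f.
by rewrite scroll_param_vanishing paramP.
Qed.

Lemma scroll_cone_scale v c : C v -> C (fun i => c * v i).
Proof.
move=> /CP zv; apply/CP => g gm; rewrite (@dhomog_meval_scale _ _ 2) ?zv ?mulr0 //.
case/mapP: gm => p _ ->.
have h2 u1 u2 : homog_deg 2 (lform u1 * lform u2 : {mpoly k[s.+1]}).
  by apply: (@dhomogM _ _ _ 1 _ 1); apply: lform_homog.
by apply: rpredB; apply: h2.
Qed.

Lemma scroll_cone_prime f g : vanishing C (f * g) -> vanishing C f \/ vanishing C g.
Proof.
rewrite !scroll_param_vanishing rmorphM => /eqP; rewrite mulf_eq0.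
by case/orP=> /eqP; [left | right].
Qed.

Lemma scroll_cone_nondegenerate u : vanishing C (lform u) -> u = 0.
Proof.
move=> /scroll_param_vanishing; rewrite scroll_paramE (subst_lform (invmx A)).
set w := u *m _ => pw0.
suff w0 : w = 0 by rewrite -[u]mulmx1 -(mulVmx uA) mulmxA -/w w0 mul0mx.
(* The exponent of the last variable in [index_weight] is the index itself, so distinct variables
   have distinct images and the coefficients of [w] can be read off. *)
apply/rowP => i; rewrite [RHS]mxE; have := congr1 (mcoeff (index_weight s e i)) pw0.
rewrite mcoeff0 /lform rmorph_sum /= raddf_sum (bigD1 i) //= -/(param k s e) paramZ paramX.
rewrite mcoeffZ mcoeffX eqxx mulr1 big1 ?addr0 // => j ne_ji.
rewrite -/(param k s e _) paramZ paramX mcoeffZ mcoeffX; case: eqP => [eq_wt|]; last by rewrite mulr0.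
have les (a : 'I_s.+1) : (a <= s)%N by rewrite -ltnS ltn_ord.
case/eqP: ne_ji; apply: val_inj.
by have := index_weight_last e (les j); rewrite eq_wt index_weight_last.
Qed.

End ScrollCone.

(** * Comparison of Hilbert polynomials *)

Section PolynomialGrowth.
Implicit Types p q : {poly rat}.

Definition eventually (P : nat -> Prop) := exists d0 : nat, forall d, (d0 <= d)%N -> P d.

Lemma eventually2 (P Q R : nat -> Prop) : (forall d, P d -> Q d -> R d) ->
  eventually P -> eventually Q -> eventually R.
Proof.
move=> PQR [d1 H1] [d2 H2]; exists (maxn d1 d2) => d.
by rewrite geq_max => /andP[/H1 + /H2]; apply: PQR.
Qed.

(** The uniform bound [eps] carries the induction from p to p X + c: for large d, eps d exceeds |1 -
    c|. *)
Lemma eventually_pos p : 0 < lead_coef p ->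
  exists2 eps, 0 < eps & eventually (fun d => eps <= p.[d%:R]).
Proof.
elim/poly_ind: p => [|p c IH]; first by rewrite lead_coef0 ltxx.
have [->|nzp] := eqVneq p 0.
  rewrite mul0r add0r lead_coefC => c0; exists c => //.
  by exists 0%N => d _; rewrite hornerC.
rewrite lead_coefDl ?lead_coefMX => [/IH[eps eps0 [d0 Hd0]]|]; last first.
  by rewrite size_mulX // size_polyC; case: eqP => //= _; rewrite ltnS lt0n size_poly_eq0.
exists 1 => //; pose N := Num.bound (`|1 - c| / eps).
exists (maxn d0 N) => d; rewrite geq_max => /andP[/Hd0 le_eps leN].
rewrite hornerD hornerMX hornerC -lerBlDr.
have ltN : `|1 - c| / eps < d%:R.
  apply: (@lt_le_trans _ _ N%:R); last by rewrite ler_nat.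
  apply: archi_boundP.
  by apply: divr_ge0; [exact: normr_ge0 | exact: ltW].
rewrite ltr_pdivrMr // in ltN.
apply: (le_trans (ler_norm _)); apply: (le_trans (ltW ltN)).
by rewrite mulrC ler_wpM2r.
Qed.

Lemma eventually_le_lead p q : eventually (fun d => p.[d%:R] <= q.[d%:R]) ->
  lead_coef (q - p) < 0 -> False.
Proof.
move=> le_pq; rewrite -oppr_gt0 -lead_coefN opprB => /eventually_pos[eps eps0].
move=> /(eventually2 _ le_pq) -/(_ (fun=> False))[|d0 /(_ d0 (leqnn _))//].
by move=> d; rewrite hornerD hornerN; lra.
Qed.

Lemma eventually_ge0_lead p : eventually (fun d => 0 <= p.[d%:R]) -> 0 <= lead_coef p.
Proof.
move=> ge0; rewrite leNgt; apply/negP => lt0.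
apply: (@eventually_le_lead 0 p); last by rewrite subr0.
by case: ge0 => d0 H; exists d0 => d /H; rewrite horner0.
Qed.

Lemma eventually_le_size p q : eventually (fun d => 0 <= p.[d%:R]) ->
  eventually (fun d => p.[d%:R] <= q.[d%:R]) -> (size p <= size q)%N.
Proof.
move=> /eventually_ge0_lead ge0 le_pq; rewrite leqNgt; apply/negP => lt.
apply: (eventually_le_lead le_pq); rewrite addrC lead_coefDl ?size_opp // lead_coefN oppr_lt0.
rewrite lt_neqAle ge0 eq_sym lead_coef_eq0 andbT -size_poly_eq0 -lt0n.
exact: leq_ltn_trans lt.
Qed.

Lemma eventually_le_lead_coef p q : size p = size q ->
  eventually (fun d => p.[d%:R] <= q.[d%:R]) -> lead_coef p <= lead_coef q.
Proof.
move=> szpq le_pq; rewrite leNgt; apply/negP => lt.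
apply: (eventually_le_lead le_pq).
have nz : lead_coef q - lead_coef p != 0 by rewrite subr_eq0 lt_eqF.
have coefE : (q - p)`_(size q).-1 = lead_coef q - lead_coef p.
  by rewrite coefB !lead_coefE szpq.
suff -> : lead_coef (q - p) = lead_coef q - lead_coef p by rewrite subr_lt0.
rewrite -coefE lead_coefE; congr (_`_ _.-1).
apply/eqP; rewrite eqn_leq; apply/andP; split.
  by apply: (leq_trans (size_polyD _ _)); rewrite size_opp szpq maxnn.
have := leq_sizeP (q - p) (size q).-1.
case: (ltnP (size (q - p)) (size q)) => // ltsz _.
case/eqP: nz; rewrite -coefE nth_default //.
by case: (size q) ltsz.
Qed.

End PolynomialGrowth.

Section HilbertCompare.
Variable k : closedFieldType.

Lemma hilb_fun_mono m (I J : {mpoly k[m]} -> Prop) d h h' :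
  (forall f, I f -> J f) -> hilb_fun J d h' -> hilb_fun I d h -> (h' <= h)%N.
Proof.
move=> IJ [[fs [<- [homfs indfs]]] _] [_ maxI]; apply: maxI => // c Ic.
exact/indfs/IJ.
Qed.

Lemma hilb_poly_ge0 m (I : {mpoly k[m]} -> Prop) P :
  hilb_poly I P -> eventually (fun d => 0 <= P.[d%:R]).
Proof. by case=> d0 H; exists d0 => d /H[h [_ ->]]; rewrite ler0n. Qed.

Lemma hilb_poly_le m n (I : {mpoly k[m]} -> Prop) (J : {mpoly k[n]} -> Prop) P Q :
  (forall d h h', hilb_fun I d h -> hilb_fun J d h' -> (h <= h')%N) ->
  hilb_poly I P -> hilb_poly J Q -> eventually (fun d => P.[d%:R] <= Q.[d%:R]).
Proof.
move=> le HP HQ; apply: eventually2 HP HQ => d [h [Hh ->]] [h' [Hh' ->]].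
by rewrite ler_nat; apply: le Hh Hh'.
Qed.

Lemma lin_indep_le_span m (J : {mpoly k[m]} -> Prop) (fs : seq {mpoly k[m]}) N
    (g : 'I_N -> {mpoly k[m]}) :
  ideal J -> lin_indep_mod J fs ->
  (forall f, f \in fs -> exists c : 'I_N -> k, J (f - \sum_i c i *: g i)) ->
  (size fs <= N)%N.
Proof.
move=> iJ /lin_indep_modP indfs spanfs.
have [c cP] : exists c : 'I_(size fs) -> 'I_N -> k,
    forall i : 'I_(size fs), J (fs`_i - \sum_j c i j *: g j).
  by apply: (@fin_all_exists _ _ (fun (i : 'I_(size fs)) c => J (fs`_i - \sum_j c j *: g j))) => i;
     apply/spanfs/mem_nth.
pose A := \matrix_(i < size fs, j < N) c i j.
suff: row_free A by move/eqP <-; apply: rank_leq_col.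
apply: inj_row_free => v vA0; apply/rowP => i; rewrite mxE.
pose w j := if insub j is Some i then v 0 i else 0.
have wE (j : 'I_(size fs)) : w j = v 0 j by rewrite /w valK.
rewrite -wE; apply: indfs => //.
have -> : \sum_(i < size fs) w i *: fs`_i
    = \sum_(i < size fs) v 0 i *: (fs`_i - \sum_j c i j *: g j).
  under [RHS]eq_bigr do rewrite scalerBr.
  rewrite sumrB [X in _ - X](_ : _ = 0) ?subr0; first by apply: eq_bigr => j _; rewrite wE.
  under eq_bigr do rewrite scaler_sumr.
  rewrite exchange_big big1 // => j _.
  move/rowP: vA0 => /(_ j); rewrite !mxE => vAj.
  under eq_bigr do rewrite scalerA.
  rewrite -scaler_suml; apply/eqP; rewrite scaler_eq0; apply/orP; left; apply/eqP.
  by rewrite -[RHS]vAj; apply: eq_bigr => l _; rewrite mxE.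
by apply: ideal_sum => // j _; apply: idealZ.
Qed.

End HilbertCompare.

(** * Projection from a point *)

Section ProjectionMatrix.
Variables (k : closedFieldType) (r : nat) (M : 'M[k]_(r.+1, r.+2)) (p : 'I_r.+2 -> k).
Hypothesis projM : projection_from M p.

Let pc : 'cV[k]_r.+2 := \col_i p i.

Lemma lform_meval_col n (u : 'rV[k]_n) (v : 'I_n -> k) :
  (lform u).@[v] = (u *m \col_i v i) 0 0.
Proof. by rewrite lform_meval mxE; apply: eq_bigr => j _; rewrite mxE. Qed.

Lemma proj_center_neq0 : pc != 0.
Proof.
case: projM => -[j pj0] _; apply: contraNneq pj0 => /colP/(_ j).
by rewrite !mxE => ->.
Qed.

Lemma proj_center_ker : M *m pc = 0.
Proof.
case: projM => _ kerM; apply/colP => i; rewrite !mxE.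
have /kerM/(congr1 (fun f => f i)) : exists c, p = (fun j => c * p j).
  by exists 1; apply: functional_extensionality => j; rewrite mul1r.
by move=> /= E; apply: etrans E; apply: eq_bigr => j _; rewrite mxE.
Qed.

Lemma proj_row_free : row_free M.
Proof.
case: projM => _ kerM; rewrite /row_free eqn_leq rank_leq_row /=.
have : (\rank (kermx M^T) <= 1)%N.
  apply: leq_trans (rank_leq_row pc^T); apply: mxrankS.
  apply/row_subP => i; set u := row i _.
  have uM : M *m u^T = 0.
    by apply: trmx_inj; rewrite trmx_mul trmxK trmx0 -row_mul mulmx_ker row0.
  have [c ucE] : exists c, u 0 = (fun j => c * p j).
    apply/kerM; apply: functional_extensionality => j.
    move/colP: uM => /(_ j); rewrite !mxE => E; apply: etrans E.
    by apply: eq_bigr => l _; rewrite ?mxE.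
  suff -> : u = c *: pc^T by apply: scalemx_sub.
  by apply/rowP => j; rewrite ucE !mxE.
by rewrite mxrank_ker mxrank_tr; lia.
Qed.

Definition lift_form : 'M[k]_(r.+2, r.+1) := pinvmx M.

(** The row space of [M] lies in the space of linear forms vanishing at [p] and has the same
    dimension, so these forms are exactly the pull-backs of linear forms on P^r. *)
Lemma lift_formK (u : 'rV[k]_r.+2) : (lform u).@[p] = 0 -> u *m lift_form *m M = u.
Proof.
rewrite lform_meval_col -/pc => up0.
have upc0 : u *m pc = 0 by apply/rowP => i; rewrite ord1 up0 mxE.
have sMK : (M <= kermx pc)%MS by apply/sub_kermxP/proj_center_ker.
have sKM : (kermx pc <= M)%MS.
  rewrite -(mxrank_leqif_sup sMK) eqn_leq mxrankS //= mxrank_ker.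
  move/eqP: proj_row_free => ->.
  have : (0 < \rank pc)%N by rewrite lt0n mxrank_eq0 proj_center_neq0.
  by case: (\rank pc) => // n _; rewrite subSS leq_subr.
by rewrite mulmxKpV // (submx_trans _ sKM) //; apply/sub_kermxP.
Qed.

Lemma lform_center (u : 'rV[k]_r.+1) : (lform (u *m M)).@[p] = 0.
Proof. by rewrite lform_meval_col -mulmxA proj_center_ker mulmx0 mxE. Qed.

Lemma image_vanishing (Ct : ('I_r.+2 -> k) -> Prop) (CX : ('I_r.+1 -> k) -> Prop) f :
  (forall v, CX v <-> exists w, Ct w /\ v = lapp M w) ->
  vanishing CX f <-> vanishing Ct (subst M f).
Proof.
move=> CXP; split=> vf v; first by move=> Cv; rewrite subst_meval; apply/vf/CXP; exists v.
by case/CXP=> w [Cw ->]; rewrite -subst_meval; apply: vf.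
Qed.

End ProjectionMatrix.

(** * The pencil of columns of a scroll *)

Section ScrollPencil.
Variables (k : closedFieldType) (s : nat) (e : pred nat) (A : 'M[k]_s.+1).
Hypothesis uA : A \in unitmx.
Variable C : ('I_s.+1 -> k) -> Prop.
Hypothesis CP : forall v, C v <-> zero_set (minors e (fun i => lform (row i A))) v.
Notation nc := (size (cols s e)).

Let col (i : 'I_nc) : nat := nth 0%N (cols s e) i.

Let col_cols i : col i \in cols s e. Proof. exact: mem_nth. Qed.
Let col_lt i : (col i < s)%N.
Proof. by have := col_cols i; rewrite mem_cols => /andP[]. Qed.

(* The two rows of the scroll matrix, as linear maps sending a combination of
   columns to (the coefficient vector of) a linear form. *)
Definition upper_mx : 'M[k]_(nc, s.+1) := \matrix_(i < nc) row (inord (col i)) A.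
Definition lower_mx : 'M[k]_(nc, s.+1) := \matrix_(i < nc) row (inord (col i).+1) A.
Definition upper : 'Hom('rV[k]_nc, 'rV[k]_s.+1) := linfun (mulmxr upper_mx).
Definition lower : 'Hom('rV[k]_nc, 'rV[k]_s.+1) := linfun (mulmxr lower_mx).

Lemma upper_mulE v : upper v = v *m upper_mx. Proof. by rewrite lfunE. Qed.
Lemma lower_mulE v : lower v = v *m lower_mx. Proof. by rewrite lfunE. Qed.

Lemma upperE v : upper v = \sum_i v 0 i *: row (inord (col i)) A.
Proof. by rewrite upper_mulE mulmx_sum_row; apply: eq_bigr => i _; rewrite rowK. Qed.
Lemma lowerE v : lower v = \sum_i v 0 i *: row (inord (col i).+1) A.
Proof. by rewrite lower_mulE mulmx_sum_row; apply: eq_bigr => i _; rewrite rowK. Qed.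

Let x (j : nat) (w : 'I_s.+1 -> k) := (lform (row (inord j) A)).@[w].

Lemma lform_sum_meval n m (v : 'rV[k]_m) (F : 'I_m -> 'rV[k]_n) w :
  (lform (\sum_i v 0 i *: F i)).@[w] = \sum_i v 0 i * (lform (F i)).@[w].
Proof.
rewrite lform_meval; under eq_bigr do rewrite summxE mulr_suml.
rewrite exchange_big; apply: eq_bigr => i _; rewrite lform_meval mulr_sumr.
by apply: eq_bigr => j _; rewrite mxE mulrA.
Qed.

Lemma upper_meval v w : (lform (upper v)).@[w] = \sum_i v 0 i * x (col i) w.
Proof. by rewrite upperE lform_sum_meval. Qed.
Lemma lower_meval v w : (lform (lower v)).@[w] = \sum_i v 0 i * x (col i).+1 w.
Proof. by rewrite lowerE lform_sum_meval. Qed.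

Lemma scroll_point_minor w j j' : C w -> j \in cols s e -> j' \in cols s e ->
  x j w * x j'.+1 w = x j' w * x j.+1 w.
Proof.
move=> Cw cj cj'; apply/eqP; rewrite -subr_eq0; apply/eqP.
have xE i : x i w = ('X_(inord i) : {mpoly k[s.+1]}).@[lapp A w].
  by rewrite -subst_meval /= comp_mpolyXU -tnth_nth tnth_mktuple.
rewrite !xE -!mevalM -mevalB.
have := cols_minor k cj cj'.
move/(gen_ideal_min (vanishing_ideal (eq (lapp A w)))); apply=> //.
by move=> g gm _ <-; move/(scroll_cone_point CP): Cw; apply.
Qed.

Lemma pencil_minor w v v' : C w ->
  (lform (upper v)).@[w] * (lform (lower v')).@[w]
  = (lform (upper v')).@[w] * (lform (lower v)).@[w].
Proof.
move=> Cw; rewrite !upper_meval !lower_meval !mulr_suml.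
under eq_bigr do rewrite mulr_sumr.
under [RHS]eq_bigr do rewrite mulr_sumr.
rewrite [RHS]exchange_big; apply: eq_bigr => i _; apply: eq_bigr => j _ /=.
transitivity (v 0 i * v' 0 j * (x (col i) w * x (col j).+1 w)); first by ring.
by rewrite (scroll_point_minor Cw) //; ring.
Qed.

Notation prm := (scroll_param e A).
Notation T := ('X_ord_max : {mpoly k[(blk e s).+2]}).

Lemma prm_lformD u v : prm (lform (u + v)) = prm (lform u) + prm (lform v).
Proof. by rewrite lformD rmorphD. Qed.
Lemma prm_lformZ c u : prm (lform (c *: u)) = c%:MP * prm (lform u).
Proof.
by rewrite lformZ !scroll_paramE (substZ (invmx A) c) paramZ mul_mpolyC.
Qed.

Lemma prm_row i : prm (lform (row i A)) = param k s e 'X_i.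
Proof. by rewrite scroll_paramE subst_lform -row_mul mulmxV // lformX. Qed.

Lemma prm_lower v : prm (lform (lower v)) = T * prm (lform (upper v)).
Proof.
have sumE (F : 'I_nc -> 'rV[k]_s.+1) :
    prm (lform (\sum_i v 0 i *: F i)) = \sum_i (v 0 i)%:MP * prm (lform (F i)).
  have prm0 : prm (lform 0) = 0 by rewrite -(scale0r 0) prm_lformZ mul0r.
  rewrite (big_morph (fun u => prm (lform u)) prm_lformD prm0).
  by apply: eq_bigr => i _; rewrite prm_lformZ.
rewrite lowerE upperE !sumE mulr_sumr; apply: eq_bigr => i _.
by rewrite !prm_row param_step // mulrCA.
Qed.

Lemma prm_inj u : prm (lform u) = 0 -> u = 0.
Proof.
by move=> pu0; apply: (scroll_cone_nondegenerate uA CP); apply/(scroll_param_vanishing uA CP).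
Qed.

Lemma upper_inj v : upper v = 0 -> v = 0.
Proof.
rewrite upperE => v0; apply/rowP => i; rewrite [RHS]mxE.
have := congr1 (fun u => (u *m invmx A) 0 (inord (col i))) v0.
rewrite mul0mx mulmx_suml summxE [RHS]mxE (bigD1 i) //= -scalemxAl mxE -row_mul mulmxV //.
rewrite !mxE eqxx mulr1 big1 ?addr0 // => j ne_ji.
rewrite -scalemxAl mxE -row_mul mulmxV // !mxE.
suff /negPf-> : inord (col j) != inord (col i) :> 'I_s.+1 by rewrite mulr0.
rewrite -val_eqE /= !inordK; try exact: (leqW (col_lt _)).
by rewrite (nth_uniq 0%N (ltn_ord j) (ltn_ord i)) // filter_uniq // iota_uniq.
Qed.

(** The monomial map sends the lower row to [T] times the upper row, so the combination becomes a +
    b T times the image of [upper v]; the ring is a domain and a + b T is not zero. *)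
Lemma pencil_injective v a b : (a != 0) || (b != 0) ->
  a *: upper v + b *: lower v = 0 -> v = 0.
Proof.
move=> ab0 /(congr1 (fun u => prm (lform u))).
rewrite prm_lformD !prm_lformZ prm_lower mulrA -mulrDl.
have -> : prm (lform 0) = 0 by rewrite -(scale0r 0) prm_lformZ mul0r.
move=> /eqP; rewrite mulf_eq0 => /orP[/eqP ab|/eqP/prm_inj/upper_inj//].
have a0 : a = 0.
  have := congr1 (mcoeff 0%MM) ab.
  by rewrite mcoeffD mcoeff0 mcoeffC mcoeffCM mcoeffX eqxx mnm1_eq0 mulr1 mulr0 addr0.
have b0 : b = 0.
  have := congr1 (mcoeff U_(ord_max)) ab.
  by rewrite mcoeffD mcoeff0 mcoeffC mcoeffCM mcoeffX eqxx mnm1_eq0 mulr1 mulr0 add0r.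
by move: ab0; rewrite a0 b0 eqxx.
Qed.

End ScrollPencil.

Local Notation gap := (fun x y : nat => x.+1 < y)%N.

Lemma dim_rowspace (k : fieldType) n : \dim {: 'rV[k]_n} = n.
Proof. by rewrite dimvf dim_matrix mul1r. Qed.

(** * From Kronecker chains to scroll matrices *)

Section ChainsToScroll.
Variables (k : closedFieldType) (U W : vectType k) (al be : 'Hom(U, W)).

Lemma nth_chain_forms (c : seq U) j : links al be c -> (j < size c)%N ->
  (chain_forms al be c)`_j = al c`_j /\ (chain_forms al be c)`_j.+1 = be c`_j.
Proof.
move=> lc ltj; rewrite /chain_forms !nth_rcons !size_map ltj (nth_map 0) //; split=> //.
have [lt|ge] := ltnP j.+1 (size c); first by rewrite (nth_map 0) // lc.
have eqj : j.+1 = size c by apply/eqP; rewrite eqn_leq ltj ge.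
by rewrite -eqj eqxx -nth_last -eqj.
Qed.

Lemma size_chain_forms (c : seq U) : size (chain_forms al be c) = (size c).+1.
Proof. by rewrite size_rcons size_map. Qed.

(** The blocks are concatenated, and the last index of the earlier ones becomes a break. A non-empty
    chain yields at least two entries, which is the gap condition on breaks. *)
Lemma chains_scroll (V : {vspace U}) (cs : seq (seq U)) :
  cs != [::] -> all (fun c => c != [::]) cs -> (forall c, c \in cs -> links al be c) ->
  {subset flatten cs <= V} ->
  let Fs := flatten (map (chain_forms al be) cs) in
  exists n a, [/\ size Fs = n.+1, (0 < n)%N && all (fun x => 0 < x < n)%N a,
    sorted gap (rcons a n), size (scroll_cols n a) = size (flatten cs)
    & forall j, j \in scroll_cols n a ->
        exists2 v, v \in V & Fs`_j = al v /\ Fs`_j.+1 = be v].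
Proof.
move=> + nz lk sV; elim/last_ind: cs nz lk sV => // cs c IH.
rewrite all_rcons => /andP[nzc nzcs] lk sV _ Fs.
have lc : links al be c by apply: lk; rewrite mem_rcons inE eqxx.
have c0 : (0 < size c)%N by case: (c) nzc.
have cV j : (j < size c)%N -> c`_j \in V.
  move=> ltj; apply: sV; rewrite flatten_rcons mem_cat; apply/orP; right.
  exact: mem_nth.
have FsE : Fs = flatten (map (chain_forms al be) cs) ++ chain_forms al be c.
  by rewrite /Fs map_rcons flatten_rcons.
have [cs0|ncs0] := eqVneq cs [::].
  exists (size c), [::]; rewrite FsE cs0 /= size_chain_forms c0; split=> //.
    by rewrite cats0 /scroll_cols filter_predT size_iota.
  move=> j; rewrite mem_filter mem_iota => /andP[_ ltj]; exists c`_j; first exact: cV.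
  exact: nth_chain_forms.
have [||n [a [szF /andP[n0 alla] sorta szcols Fcols]]] := IH nzcs _ _ ncs0.
- by move=> c1 c1s; apply: lk; rewrite mem_rcons inE c1s orbT.
- by move=> v vcs; apply: sV; rewrite flatten_rcons mem_cat vcs.
have colsE : scroll_cols (n + (size c).+1) (rcons a n)
    = scroll_cols n a ++ iota n.+1 (size c).
  rewrite /scroll_cols iotaD filter_cat add0n; congr (_ ++ _).
    apply: eq_in_filter => j; rewrite mem_iota mem_rcons inE negb_or => /andP[_ ltj].
    by rewrite neq_ltn ltj.
  rewrite /= mem_rcons inE eqxx /=; apply/all_filterP/allP => j.
  rewrite mem_iota mem_rcons inE negb_or => /andP[ltnj _].
  rewrite (gtn_eqF ltnj) /=; apply/negP => /(allP alla)/andP[_ ltjn].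
  by have := ltn_trans ltnj ltjn; rewrite ltnn.
exists (n + (size c).+1)%N, (rcons a n); split.
- by rewrite FsE size_cat szF size_chain_forms addSn.
- rewrite addn_gt0 n0 all_rcons n0 /= addnS ltnS leq_addr /=.
  apply/allP => j /(allP alla)/andP[-> ltjn] /=; lia.
- have gapn : gap n (n + (size c).+1)%N by lia.
  case: (a) sorta => [|x a'] /=; first by rewrite gapn.
  by move=> sp; rewrite rcons_path last_rcons sp gapn.
- by rewrite colsE size_cat szcols size_iota flatten_rcons size_cat.
move=> j; rewrite colsE mem_cat => /orP[jcols|].
  have ltjn : (j < n)%N by move: jcols; rewrite mem_filter mem_iota => /andP[].
  have [v Vv [Fj FSj]] := Fcols j jcols; exists v => //.
  by rewrite FsE !nth_cat szF ltnS (ltnW ltjn) ltnS ltjn Fj FSj.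
rewrite mem_iota => /andP[ltnj ltj].
have lti : (j - n.+1 < size c)%N by lia.
have [Fj FSj] := nth_chain_forms lc lti.
exists c`_(j - n.+1); first exact: cV.
rewrite FsE !nth_cat szF ltnNge ltnj /= ltnNge (ltnW ltnj : (n.+1 <= j.+1)%N) /=.
by rewrite Fj subSn.
Qed.

End ChainsToScroll.

Section ScrollData.
Variables (s n : nat) (a : seq nat).
Hypothesis sd : scroll_data s n a.

(** Every index from [n] on is also a cut, so each vertex variable forms a block without columns and
    cones are treated like scrolls. *)
Definition breaks (j : nat) : bool := (j \in a) || (n <= j)%N.

Lemma scroll_cols_breaks : scroll_cols n a = cols s breaks.
Proof.
case: sd => /andP[_ le_ns] _; rewrite /scroll_cols /cols -(subnKC le_ns) iotaD filter_cat add0n.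
rewrite -[LHS]cats0; congr (_ ++ _).
  apply: eq_in_filter => j; rewrite mem_iota /breaks negb_or => /andP[_ ltj].
  by rewrite -ltnNge ltj andbT.
apply/esym/eqP; rewrite -size_eq0 size_filter -leqn0 leqNgt -has_count; apply/hasPn => j.
by rewrite mem_iota /breaks => /andP[-> _]; rewrite orbT.
Qed.

(** Two consecutive indices are never both breaks, so an index that is not the upper entry of a
    column is the lower entry of the preceding one; hence the matrix contains all variables up to
    [n]. *)
Lemma scroll_index_cases i : (i <= n)%N ->
  i \in scroll_cols n a \/ (0 < i)%N /\ i.-1 \in scroll_cols n a.
Proof.
case: sd => /andP[n0 _] [a0 sorta] le_in.
have [ic|nic] := boolP (i \in scroll_cols n a); [by left | right].
have gapT : transitive gap by move=> y x z /= xy yz; lia.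
have gap_neq x y : x \in rcons a n -> y \in rcons a n -> x.+1 <> y.
  move=> xa ya eqxy.
  have lt_xy := @sorted_ltn_nth _ _ gapT 0%N _ sorta (index x (rcons a n)) (index y (rcons a n)).
  have lt_yx := @sorted_ltn_nth _ _ gapT 0%N _ sorta (index y (rcons a n)) (index x (rcons a n)).
  rewrite !inE !index_mem !nth_index // in lt_xy lt_yx.
  case: (ltngtP (index x (rcons a n)) (index y (rcons a n))) => [/lt_xy|/lt_yx|eqi].
  - by move=> /(_ xa ya); lia.
  - by move=> /(_ ya xa); lia.
  - by have := nth_index 0%N xa; rewrite eqi nth_index //; lia.
move: nic; rewrite mem_filter mem_iota add0n negb_and negbK leq0n -leqNgt => iF.
have ia : i \in rcons a n.
  rewrite mem_rcons inE; case/orP: iF => [->|le_ni]; first by rewrite orbT.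
  by rewrite eqn_leq le_in le_ni.
have i0 : (0 < i)%N.
  move: ia; rewrite mem_rcons inE => /orP[/eqP->//|]; exact: (allP a0).
split=> //; rewrite mem_filter mem_iota add0n /=; apply/andP; split; last by rewrite prednK.
apply/negP => pia; apply: (gap_neq i.-1 i) => //; last by rewrite prednK.
by rewrite mem_rcons inE pia orbT.
Qed.

End ScrollData.

(** * Columns vanishing at the centre of projection *)

Section ScrollCenter.
Variables (k : closedFieldType) (s : nat) (e : pred nat) (A : 'M[k]_s.+1).
Hypothesis uA : A \in unitmx.
Variable C : ('I_s.+1 -> k) -> Prop.
Hypothesis CP : forall v, C v <-> zero_set (minors e (fun i => lform (row i A))) v.
Variable p : 'I_s.+1 -> k.
Hypothesis Cp : ~ C p.
Notation nc := (size (cols s e)).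
Notation up := (upper e A).
Notation lo := (lower e A).

Lemma independent_columns : exists v1 v2,
  [/\ (lform (up v1)).@[p] = 1, (lform (lo v1)).@[p] = 0,
      (lform (up v2)).@[p] = 0 & (lform (lo v2)).@[p] = 1].
Proof.
have /hasP[g gm] : has (fun g => g.@[p] != 0) (minors e (fun i => lform (row i A))).
  apply: contraT => /hasPn np; case: Cp; apply/CP => g /np.
  by rewrite negbK => /eqP.
case/mapP: gm => -[j j']; rewrite mem_filter => /andP[_ /allpairsP[[i i'] [/= ci ci' [-> ->]]]] -> {g}.
rewrite /= mevalB !mevalM.
set x := fun j => (lform (row (inord j) A)).@[p].
rewrite -![(lform (row (inord _) A)).@[p]]/(x _) => D0.
pose col (i : 'I_nc) := nth 0%N (cols s e) i.
have [ji jiE] : exists ji : 'I_nc, col ji = i.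
  by move: ci; rewrite -index_mem => lti; exists (Ordinal lti); rewrite /col nth_index // -index_mem.
have [ji' ji'E] : exists ji : 'I_nc, col ji = i'.
  by move: ci'; rewrite -index_mem => lti; exists (Ordinal lti); rewrite /col nth_index // -index_mem.
have evU (a b : k) : (lform (up (a *: delta_mx 0 ji + b *: delta_mx 0 ji'))).@[p] = a * x i + b * x i'.
  have upd q : up (delta_mx 0 q) = row (inord (col q)) A.
    rewrite upperE (bigD1 q) //= mxE !eqxx scale1r big1 ?addr0 // => q' /negPf nq.
    by rewrite mxE nq andbF scale0r.
  by rewrite linearD !linearZ /= !upd lformD !lformZ mevalD !mevalZ jiE ji'E.
have evL (a b : k) : (lform (lo (a *: delta_mx 0 ji + b *: delta_mx 0 ji'))).@[p] = a * x i.+1 + b * x i'.+1.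
  have lod q : lo (delta_mx 0 q) = row (inord (col q).+1) A.
    rewrite lowerE (bigD1 q) //= mxE !eqxx scale1r big1 ?addr0 // => q' /negPf nq.
    by rewrite mxE nq andbF scale0r.
  by rewrite linearD !linearZ /= !lod lformD !lformZ mevalD !mevalZ jiE ji'E.
set D := x i * x i'.+1 - x i' * x i.+1 in D0.
(* Cramer's rule: these combinations invert the 2 x 2 matrix of values at [p] of the columns [i] and
   [i'], with determinant [D]. *)
exists (x i'.+1 / D *: delta_mx 0 ji + - x i.+1 / D *: delta_mx 0 ji').
exists (- x i' / D *: delta_mx 0 ji + x i / D *: delta_mx 0 ji').
by rewrite !evU !evL; split; rewrite /D; field; rewrite -?/D.
Qed.

Definition center_cols : {vspace 'rV[k]_nc} :=
  lker (linfun (mulmxr (row_mx (upper_mx e A *m \col_i p i) (lower_mx e A *m \col_i p i)))).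

Lemma center_colsP v : v \in center_cols <->
  (lform (up v)).@[p] = 0 /\ (lform (lo v)).@[p] = 0.
Proof.
rewrite memv_ker lfunE /= mul_mx_row row_mx_eq0 !mulmxA -upper_mulE -lower_mulE.
rewrite !lform_meval_col; split=> [/andP[/eqP-> /eqP->]|[u0 l0]]; first by rewrite mxE.
by apply/andP; split; apply/eqP/rowP => i; rewrite ord1 ?u0 ?l0 mxE.
Qed.

Lemma dim_center_cols : (\dim center_cols + 2 = nc)%N.
Proof.
have [v1 [v2 [u1 l1 u2 l2]]] := independent_columns.
rewrite /center_cols; set f := linfun _.
have := limg_ker_dim f fullv; rewrite capfv dim_rowspace => dimE.
apply: etrans dimE; congr (_ + _)%N.
suff -> : limg f = fullv by rewrite dim_rowspace.
have fE v (a b : k) : (lform (up v)).@[p] = a -> (lform (lo v)).@[p] = b ->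
    f v = row_mx (a%:M : 'M_1) (b%:M : 'M_1).
  have -> : f v = v *m row_mx (upper_mx e A *m \col_i p i) (lower_mx e A *m \col_i p i).
    by rewrite /f lfunE.
  rewrite !lform_meval_col mul_mx_row !mulmxA -upper_mulE -lower_mulE => <- <-.
  by congr row_mx; apply: mx11_scalar.
apply/eqP; rewrite eqEsubv subvf; apply/subvP => u _.
apply/memv_imgP; exists (u 0 (lshift 1 0) *: v1 + u 0 (rshift 1 0) *: v2); first exact: memvf.
rewrite linearD !linearZ /= (fE v1 _ _ u1 l1) (fE v2 _ _ u2 l2).
rewrite -[LHS]hsubmxK !scale_row_mx add_row_mx; congr row_mx; apply/rowP => i;
  by rewrite ord1 !mxE /= ?mulr1 ?mulr0 ?addr0 ?add0r //; congr (u _ _); apply: val_inj.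
Qed.

End ScrollCenter.

(** * Counting the surviving entries *)

Section VertexDimension.
Variables (k : closedFieldType) (s n : nat) (a : seq nat) (A : 'M[k]_s.+1).
Hypothesis uA : A \in unitmx.
Hypothesis sd : scroll_data s n a.
Notation e := (breaks n a).
Variable C : ('I_s.+1 -> k) -> Prop.
Hypothesis CP : forall v, C v <-> zero_set (minors e (fun i => lform (row i A))) v.
Variable p : 'I_s.+1 -> k.
Hypothesis Cp : ~ C p.
Notation nc := (size (cols s e)).
Notation up := (upper e A).
Notation lo := (lower e A).
Notation V := (center_cols e A p).
Variable Fs : seq 'rV[k]_s.+1.
Hypothesis freeFs : free Fs.
Hypothesis Fs_ge : ((up @: V) + (lo @: V) <= <<Fs>>)%VS.
Hypothesis Fs_le : (<<Fs>> <= (up @: V) + (lo @: V))%VS.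

Let rows (l : seq nat) : seq 'rV[k]_s.+1 := [seq row (inord i) A | i <- l].

Lemma free_rows : free (rows (iota 0 n.+1)).
Proof.
case: sd => /andP[_ le_ns] _.
suff : free (rows (iota 0 s.+1)).
  have -> : iota 0 s.+1 = iota 0 n.+1 ++ iota n.+1 (s - n).
    by rewrite -iotaD addSn subnKC.
  by rewrite /rows map_cat; apply: catl_free.
rewrite /free size_map size_iota eqn_leq (leq_trans (dim_span _)) ?size_map ?size_iota //=.
suff -> : <<rows (iota 0 s.+1)>>%VS = fullv by rewrite dim_rowspace.
apply/eqP; rewrite eqEsubv subvf; apply/subvP => u _.
rewrite -[u]mulmx1 -(mulVmx uA) mulmxA mulmx_sum_row; apply: rpred_sum => i _; apply: rpredZ.
apply: memv_span; apply/mapP; exists (val i); last by rewrite inord_val.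
by rewrite mem_iota ltn_ord.
Qed.

Lemma rows_memP (l : seq nat) (m : nat) (v : 'rV[k]_m) (c : 'I_m -> nat) :
  (forall i, c i \in l) -> \sum_i v 0 i *: row (inord (c i)) A \in <<rows l>>%VS.
Proof.
move=> mclass; apply: rpred_sum => i _; apply: rpredZ; apply: memv_span; apply: map_f.
exact: mclass.
Qed.

Lemma entries_in_rows v :
  up v \in <<rows (iota 0 n.+1)>>%VS /\ lo v \in <<rows (iota 0 n.+1)>>%VS.
Proof.
have ltn (i : 'I_nc) : (nth 0%N (cols s e) i < n)%N.
  have : nth 0%N (cols s e) i \in scroll_cols n a.
    rewrite (scroll_cols_breaks sd); exact: mem_nth.
  by rewrite mem_filter mem_iota => /andP[].
split; [rewrite upperE | rewrite lowerE]; apply: (rows_memP v) => i;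
  rewrite mem_iota add0n /= ltnS //.
exact: ltnW.
Qed.

(** All forms in the span of [Fs] vanish at [p], but some upper entry of the full matrix does not;
    so this span is proper in that of the [n.+1] variables of the matrix. *)
Lemma size_entries_upper : (size Fs <= n)%N.
Proof.
have [v1 [v2 [u1 _ _ _]]] := independent_columns CP Cp.
have sub : (<<Fs>> <= <<rows (iota 0 n.+1)>>)%VS.
  apply: (subv_trans Fs_le); rewrite subv_add; apply/andP; split; apply/subvP => w /memv_imgP[v _ ->];
    by case: (entries_in_rows v).
rewrite -(eqP freeFs) -ltnS.
have <- : \dim <<rows (iota 0 n.+1)>> = n.+1.
  by rewrite (eqP free_rows) size_map size_iota.
rewrite ltn_neqAle dimvS // andbT; apply/eqP => eqd.
have eqS : <<Fs>>%VS = <<rows (iota 0 n.+1)>>%VS by apply/eqP; rewrite eqEdim sub eqd /=.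
have upF : up v1 \in <<Fs>>%VS by rewrite eqS; case: (entries_in_rows v1).
have := subvP Fs_le _ upF; move/memv_addP=> [x /memv_imgP[v Vv ->] [y /memv_imgP[v' Vv' ->] E]].
have /center_colsP[uv _] := Vv; have /center_colsP[_ lv'] := Vv'.
have : (lform (up v1)).@[p] = 0 by rewrite E lformD mevalD uv lv' addr0.
by rewrite u1 => /eqP; rewrite oner_eq0.
Qed.

(** A complement of [V] has dimension 2, so its images under the two rows add at most 2 + 2
    dimensions to the span of [Fs], and together they reach all [n.+1] variables. *)
Lemma size_entries_lower : (n.+1 <= size Fs + 4)%N.
Proof.
have dimV := dim_center_cols CP Cp.
rewrite -(eqP freeFs) -[n.+1](size_iota 0) -(size_map (fun i => row (inord i) A)).
rewrite -/(rows _) -(eqP free_rows).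
have sub : (<<rows (iota 0 n.+1)>> <= (<<Fs>> + up @: V^C) + lo @: V^C)%VS.
  have limV (f : 'Hom('rV[k]_nc, 'rV[k]_s.+1)) v : (f @: V <= <<Fs>>)%VS ->
      f v \in (<<Fs>> + f @: V^C)%VS.
    move=> fV; have : v \in (V + V^C)%VS by rewrite addv_complf memvf.
    case/memv_addP=> x xV [y yV ->]; rewrite linearD; apply: memv_add.
      by apply: (subvP fV); apply: memv_img.
    exact: memv_img.
  have upIn v : up v \in ((<<Fs>> + up @: V^C) + lo @: V^C)%VS.
    apply: (subvP (addvSl _ _)); apply: limV; apply: subv_trans Fs_ge; exact: addvSl.
  have loIn v : lo v \in ((<<Fs>> + up @: V^C) + lo @: V^C)%VS.
    rewrite -addvA [(up @: _ + _)%VS]addvC addvA.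
    apply: (subvP (addvSl _ _)); apply: limV; apply: subv_trans Fs_ge; exact: addvSr.
  have upd j (c : 'I_nc) : nth 0%N (cols s e) c = j -> up (delta_mx 0 c) = row (inord j) A.
    move=> <-; rewrite upperE (bigD1 c) //= mxE !eqxx scale1r big1 ?addr0 // => q /negPf nq.
    by rewrite mxE nq andbF scale0r.
  have lod j (c : 'I_nc) : nth 0%N (cols s e) c = j -> lo (delta_mx 0 c) = row (inord j.+1) A.
    move=> <-; rewrite lowerE (bigD1 c) //= mxE !eqxx scale1r big1 ?addr0 // => q /negPf nq.
    by rewrite mxE nq andbF scale0r.
  have colE j : j \in cols s e -> exists c : 'I_nc, nth 0%N (cols s e) c = j.
    by rewrite -index_mem => lt; exists (Ordinal lt); rewrite nth_index // -index_mem.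
  apply/span_subvP => w /mapP[i]; rewrite mem_iota add0n ltnS => /andP[_ le_in] ->.
  case: (scroll_index_cases sd le_in); rewrite (scroll_cols_breaks sd).
    by case/colE=> c /upd <-.
  by case=> i0 /colE[c /lod]; rewrite prednK // => <-.
have dimf (f : 'Hom('rV[k]_nc, 'rV[k]_s.+1)) : (\dim (f @: V^C) <= 2)%N.
  have := limg_ker_dim f V^C; rewrite dimv_compl dim_rowspace => dE.
  have : (\dim (f @: V^C) <= nc - \dim V)%N by rewrite -dE leq_addl.
  by move: dimV; clear; lia.
apply: (leq_trans (dimvS sub)).
have := dimf up; have := dimf lo.
have := (dimv_add_leqif (<<Fs>> + up @: V^C) (lo @: V^C)).1.
have := (dimv_add_leqif <<Fs>> (up @: V^C)).1.
by clear; lia.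
Qed.

End VertexDimension.

Lemma is_scrollP (k : closedFieldType) (s : nat) (C : ('I_s.+1 -> k) -> Prop) (vd : int) :
  is_scroll C vd <-> exists (A : 'M[k]_s.+1) (n : nat) (a : seq nat),
    [/\ A \in unitmx, scroll_data s n a, vd = s%:Z - n%:Z - 1 &
     forall v, C v <-> zero_set (minors (breaks n a) (fun i => lform (row i A))) v].
Proof.
have LE (A : 'M[k]_s.+1) :
    (fun i : 'I_s.+1 => \sum_(j < s.+1) A i j *: 'X_j) = (fun i => lform (row i A)).
  by apply: functional_extensionality => i; apply: eq_bigr => j _; rewrite mxE.
have mE (A : 'M[k]_s.+1) n a : scroll_data s n a ->
    scroll_minors (fun i => lform (row i A)) n a
    = minors (breaks n a) (fun i => lform (row i A)).
  by move=> sd; rewrite /scroll_minors (scroll_cols_breaks sd).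
split=> [[A [n [a [uA [sd [vdE]]]]]]|[A [n [a [uA sd vdE CP]]]]].
  by rewrite /= LE mE // => -[CP _]; exists A, n, a.
exists A, n, a; do 3!split=> //; rewrite /= LE mE //; split=> // f.
exact: scroll_ideal_vanishing.
Qed.

Lemma pihomog_subst (k : closedFieldType) p q (M : 'M[k]_(p, q)) d f :
  pihomog mdeg d (subst M f) = subst M (pihomog mdeg d f).
Proof.
rewrite {1}[f](pihomog_partitionE (leqnn (msize f))) rmorph_sum linear_sum.
have hom i : homog_deg i (subst M (pihomog mdeg i f)) by apply: subst_homog; apply: pihomogP.
have [le_fd|lt_df] := leqP (msize f) d.
  rewrite (pihomog_oversize le_fd) rmorph0; apply: big1 => i _.
  apply: (pihomog_ne0 _ (hom i)).
  by rewrite neq_ltn (leq_trans (ltn_ord i)).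
rewrite (bigD1 (Ordinal lt_df)) //= big1 ?addr0; first exact: pihomog_dE (hom d).
by move=> i ne_id; apply: (pihomog_ne0 _ (hom i)).
Qed.

(** * The coordinate rings of the scroll and of its projection *)

Section Projection.
Variables (k : closedFieldType) (r n : nat) (a : seq nat) (A : 'M[k]_r.+2).
Hypothesis uA : A \in unitmx.
Notation e := (breaks n a).
Variable Ct : ('I_r.+2 -> k) -> Prop.
Hypothesis CP : forall v, Ct v <-> zero_set (minors e (fun i => lform (row i A))) v.
Variables (M : 'M[k]_(r.+1, r.+2)) (p : 'I_r.+2 -> k).
Hypothesis Cp : ~ Ct p.
Hypothesis projM : projection_from M p.
Variable CX : ('I_r.+1 -> k) -> Prop.
Hypothesis CXP : forall v, CX v <-> exists w, Ct w /\ v = lapp M w.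
Notation nc := (size (cols r.+1 e)).
Notation up := (upper e A).
Notation lo := (lower e A).
Notation V := (center_cols e A p).

Definition descend (u : 'rV[k]_r.+2) := u *m lift_form M.

Lemma descendE u w : (lform u).@[p] = 0 ->
  (lform u).@[w] = (lform (descend u)).@[lapp M w].
Proof.
by move=> up0; rewrite -subst_meval (subst_lform M) /descend (lift_formK projM).
Qed.

Lemma CX_scale v c : CX v -> CX (fun i => c * v i).
Proof.
case/CXP=> w [Cw ->]; apply/CXP; exists (fun i => c * w i); split.
  exact: scroll_cone_scale CP _ _ Cw.
apply: functional_extensionality => i; rewrite /lapp mulr_sumr.
by apply: eq_bigr => j _; rewrite mulrCA.
Qed.

(* A linear form [y] with [y p = 1] generates the coordinate ring of the scroll
   over that of its projection: modulo the scroll it satisfies a monic quadratic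
   equation (first clause), and the entries of the columns vanishing at the
   centre multiply it into the smaller ring (second clause). *)
Lemma center_form : exists y : 'rV[k]_r.+2, [/\ (lform y).@[p] = 1,
  exists b c d : 'rV[k]_r.+1, forall w, Ct w -> (lform y).@[w] ^+ 2 =
    (lform b).@[lapp M w] * (lform c).@[lapp M w] - (lform d).@[lapp M w] * (lform y).@[w]
  & forall v, v \in V -> (exists G, forall w, Ct w ->
      G.@[lapp M w] = (lform (up v)).@[w] * (lform y).@[w]) /\
      (exists G, forall w, Ct w -> G.@[lapp M w] = (lform (lo v)).@[w] * (lform y).@[w])].
Proof.
have [v1 [v2 [u1 l1 u2 l2]]] := independent_columns CP Cp.
(* With y = up v1 and lo v2 = y + d, the form [d] and the other two entries of these columns vanish
   at [p] and descend. The minor of [v1] and [v2] is the quadratic equation of y; the minors of [v]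
   with [v2] and with [v1] give the two products. *)
pose d := lo v2 - up v1.
have evB u u' w : (lform (u - u')).@[w] = (lform u).@[w] - (lform u').@[w].
  by rewrite lformD mevalD -scaleN1r lformZ mevalZ mulN1r.
have dp : (lform d).@[p] = 0 by rewrite evB l2 u1 subrr.
have l2E w : (lform (lo v2)).@[w] = (lform (up v1)).@[w] + (lform d).@[w].
  by rewrite evB addrC subrK.
exists (up v1); split=> //.
  exists (descend (lo v1)), (descend (up v2)), (descend d) => w Cw.
  rewrite -!descendE //.
  have := pencil_minor CP v1 v2 Cw; rewrite l2E => E.
  by rewrite [_ * (lform (up v2)).@[w]]mulrC -E; ring.
move=> v /center_colsP[uv lv]; split.
  exists (lform (descend (up v2)) * lform (descend (lo v))
          - lform (descend d) * lform (descend (up v))) => w Cw.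
  rewrite mevalB !mevalM -!descendE //.
  have := pencil_minor CP v v2 Cw; rewrite l2E => E.
  by rewrite -E; ring.
exists (lform (descend (up v)) * lform (descend (lo v1))) => w Cw.
rewrite mevalM -!descendE // (pencil_minor CP v v1 Cw); exact: mulrC.
Qed.

Section Decomposition.
Variables (y : 'rV[k]_r.+2) (b c d : 'rV[k]_r.+1).
Hypothesis yp : (lform y).@[p] = 1.
Hypothesis yE : forall w, Ct w -> (lform y).@[w] ^+ 2 =
  (lform b).@[lapp M w] * (lform c).@[lapp M w] - (lform d).@[lapp M w] * (lform y).@[w].

Definition decomposes (D : nat) (f : {mpoly k[r.+2]}) := exists G0 G1 : {mpoly k[r.+1]},
  [/\ homog_deg D G0, (if D is D'.+1 then homog_deg D' G1 else G1 = 0)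
    & forall w, Ct w -> f.@[w] = G0.@[lapp M w] + (lform y).@[w] * G1.@[lapp M w]].

(** Induction on the degree of monomials: each variable is a form descending to P^r plus a multiple
    of [y], and the quadratic equation removes the square of [y] that multiplication produces. *)
Lemma homog_decomposes D f : homog_deg D f -> decomposes D f.
Proof.
have dZ D0 x f0 : decomposes D0 f0 -> decomposes D0 (x *: f0).
  case=> G0 [G1 [h0 h1 E]]; exists (x *: G0), (x *: G1); split.
  - exact: rpredZ.
  - by case: D0 h0 h1 => [_ ->|D' _ h1]; [rewrite scaler0 | exact: rpredZ].
  - by move=> w Cw; rewrite !mevalZ E //; ring.
have dD D0 f0 f1 : decomposes D0 f0 -> decomposes D0 f1 -> decomposes D0 (f0 + f1).
  case=> G0 [G1 [h0 h1 E]] [H0 [H1 [g0 g1 E']]]; exists (G0 + H0), (G1 + H1); split.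
  - exact: rpredD.
  - by case: D0 h0 h1 g0 g1 => [_ -> _ ->|D' _ h1 _ g1]; [rewrite addr0 | exact: rpredD].
  - by move=> w Cw; rewrite !mevalD E // E' //; ring.
have d0 D0 : decomposes D0 0.
  exists 0, 0; split; first exact: rpred0.
    by case: D0 => // D'; apply: rpred0.
  by move=> w _; rewrite !meval0 mulr0 addr0.
have dX D0 i f0 : decomposes D0 f0 -> decomposes D0.+1 ('X_i * f0).
  case=> G0 [G1 [h0 h1 E]]; pose x := p i.
  pose u := row i 1%:M - x *: y.
  have uE w : (lform u).@[w] = w i - x * (lform y).@[w].
    by rewrite lformD lformX -scaleNr lformZ mevalD mevalZ mevalXU mulNr.
  have up0 : (lform u).@[p] = 0 by rewrite uE yp mulr1 subrr.
  pose u' := lform (descend u).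
  have uw w : u'.@[lapp M w] = w i - x * (lform y).@[w] by rewrite -uE descendE.
  exists (u' * G0 + x *: (lform b * lform c * G1)), (x *: G0 + u' * G1 - x *: (lform d * G1)).
  have homM v D' (G : {mpoly k[r.+1]}) : homog_deg D' G -> homog_deg D'.+1 (lform v * G).
    by move=> hG; rewrite -[D'.+1]add1n; apply: dhomogM => //; apply: lform_homog.
  have homM0 v : homog_deg D0 (lform v * G1).
    by case: D0 h0 h1 => [_ ->|D' _ h1]; [rewrite mulr0; apply: rpred0 | exact: homM].
  split.
  - by apply: rpredD; [exact: homM | apply: rpredZ; rewrite -mulrA; apply: homM].
  - by apply: rpredB; [apply: rpredD|]; [exact: rpredZ|exact: homM0|apply: rpredZ; exact: homM0].
  move=> w Cw; rewrite !(mevalD, mevalN, mevalZ, mevalM, mevalXU) E // uw.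
  set Y := (lform y).@[w].
  have Y2 := yE Cw; rewrite -/Y in Y2.
  have bcE : (lform b).@[lapp M w] * (lform c).@[lapp M w]
      = Y ^+ 2 + (lform d).@[lapp M w] * Y by rewrite Y2 subrK.
  by rewrite bcE; ring.
move=> homf; rewrite [f]mpolyE big_seq.
have dmon m : mdeg m = D -> decomposes D 'X_[m].
  elim: D {homf} m => [|D IH] m degm.
    exists 1, 0; split=> //; first exact: dhomog1.
    move=> w _; have /eqP -> : m == 0%MM by rewrite -mdeg_eq0 degm.
    by rewrite mpolyX0 !meval1 meval0 mulr0 addr0.
  have [i mi] : exists i, (0 < m i)%N.
    apply/existsP; apply: contra_eqT degm => /existsPn m0.
    rewrite mdegE big1 // => i _; apply/eqP; by have := m0 i; rewrite -eqn0Ngt.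
  have le1 : (U_(i) <= m)%MM by rewrite lep1mP -lt0n.
  rewrite -(submK le1) addmC mpolyXD; apply: dX; apply: IH.
  apply/eqP; rewrite -eqSS -degm -[in X in _ == X](submK le1) mdegD mdeg1 addn1 //.
apply: (big_ind (decomposes D)) => //; first exact: dD.
by move=> m mf; apply: dZ; apply: dmon; move/dhomogP: homf; apply.
Qed.

Lemma hilb_scroll_le_image D hB h0 h1 :
  hilb_fun (vanishing Ct) D.+1 hB -> hilb_fun (vanishing CX) D.+1 h0 ->
  hilb_fun (vanishing CX) D h1 -> (hB <= h0 + h1)%N.
Proof.
move=> [[fs [<- [homfs indfs]]] _].
case/(hilb_fun_span (vanishing_ideal CX))=> gs0 [<- _ span0].
case/(hilb_fun_span (vanishing_ideal CX))=> gs1 [<- _ span1].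
pose g (i : 'I_(size gs0 + size gs1)) := match split i with
  | inl j => subst M gs0`_j | inr j => lform y * subst M gs1`_j end.
apply: (lin_indep_le_span (g := g) (vanishing_ideal Ct) indfs) => f /homfs.
case/homog_decomposes=> G0 [G1 [/span0[c0 c0P] /span1[c1 c1P] E]].
exists (fun i => match split i with inl j => c0 j | inr j => c1 j end) => w Cw.
rewrite mevalB E // big_split_ord /=.
have sub0 : G0.@[lapp M w] = (\sum_i c0 i *: gs0`_i).@[lapp M w].
  by apply/eqP; rewrite -subr_eq0 -mevalB c0P //; apply/CXP; exists w.
have sub1 : G1.@[lapp M w] = (\sum_i c1 i *: gs1`_i).@[lapp M w].
  by apply/eqP; rewrite -subr_eq0 -mevalB c1P //; apply/CXP; exists w.
rewrite sub0 sub1; apply/eqP; rewrite subr_eq0 mevalD; apply/eqP; congr (_ + _).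
  rewrite !raddf_sum; apply: eq_bigr => i _ /=.
  by rewrite /g (unsplitK (inl i)) !mevalZ subst_meval.
set Y := (lform y).@[w]; rewrite !raddf_sum mulr_sumr; apply: eq_bigr => i _ /=.
by rewrite /g (unsplitK (inr i)) !mevalZ mevalM subst_meval -/Y mulrCA.
Qed.

End Decomposition.

Lemma hilb_image_le_scroll D h h' :
  hilb_fun (vanishing CX) D h -> hilb_fun (vanishing Ct) D h' -> (h <= h')%N.
Proof.
move=> [[fs [<- [homfs indfs]]] _] [_ maxB]; rewrite -(size_map (subst M)); apply: maxB.
  by move=> f /mapP[g /homfs hg ->]; apply: subst_homog.
apply: lin_indep_mod_map indfs => [f g|x f|f]; [exact: rmorphD|exact: substZ|].
exact: image_vanishing.
Qed.

(** The Hilbert polynomial of the scroll lies between P(d) and P(d) + P(d - 1), the upper bound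
    coming from B = A + y A and having size at most that of [P]. *)
Lemma hilb_poly_image_size P : hilb_poly (vanishing CX) P ->
  size P = size (scroll_poly (blk e r.+1).+1 nc).
Proof.
move=> HP; have HB := scroll_cone_hilb_poly uA CP; set Q := scroll_poly _ _ in HB *.
apply/eqP; rewrite eqn_leq; apply/andP; split.
  apply: eventually_le_size; first exact: hilb_poly_ge0 HP.
  exact: hilb_poly_le hilb_image_le_scroll HP HB.
have [y [yp [b [c [d yE]]] _]] := center_form.
have szP : (size (P + (P \Po ('X - 1%:P)))%R <= size P)%N.
  apply: (leq_trans (size_polyD _ _)).
  by rewrite size_comp_poly2 ?size_XsubC // maxnn.
apply: (leq_trans _ szP); apply: eventually_le_size; first exact: hilb_poly_ge0 HB.
case: HP HB => dP HP [dB HB]; exists (maxn dP dB).+1 => -[|D] //.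
rewrite ltnS geq_max => /andP[leP leB].
have [hB [HhB ->]] := HB D.+1 (leqW leB).
have [h0 [Hh0 E0]] := HP D.+1 (leqW leP); have [h1 [Hh1 E1]] := HP D leP.
rewrite hornerD horner_comp E0 hornerXsubC -natr1 addrK E1 -natrD ler_nat.
exact: (hilb_scroll_le_image yp yE HhB Hh0 Hh1).
Qed.

End Projection.

Lemma bounded_max (P : nat -> Prop) b :
  P 0%N -> (forall t, P t -> (t <= b)%N) -> exists t, P t /\ forall t', P t' -> (t' <= t)%N.
Proof.
elim: b => [|b IH] P0 Pb; first by exists 0%N.
have [Pb1|nPb1] := classic (P b.+1); first by exists b.+1.
apply: IH => // t Pt; have := Pb t Pt; rewrite leq_eqVlt => /orP[/eqP eqt|//].
by case: nPb1; rewrite -eqt.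
Qed.

Lemma full_basis_unitmx (k : fieldType) m (B : seq 'rV[k]_m.+1) :
  free B -> size B = m.+1 -> (\matrix_(i < m.+1) B`_i) \in unitmx.
Proof.
move=> freeB szB; rewrite -row_free_unit; apply: inj_row_free => v vB0.
have sB : size B == m.+1 by rewrite szB.
apply/rowP => i; rewrite [RHS]mxE.
have /freeP/(_ (v 0)) : free (Tuple sB) by [].
apply; rewrite -[RHS]vB0 mulmx_sum_row; apply: eq_bigr => j _; by rewrite rowK.
Qed.

(* Compare with the polynomial ring, the scroll whose matrix has one column. *)
Lemma hilb_poly_lead_le (k : closedFieldType) (r : nat) (I : {mpoly k[r.+1]} -> Prop) P :
  (0 < r)%N -> ideal I -> hilb_poly I P -> size P = r.+1 -> lead_coef P * r`!%:R <= 1.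
Proof.
move=> r0 iI HP szP; pose e := fun j => (0 < j)%N.
have colsE : cols r e = [:: 0%N].
  rewrite /cols -(prednK r0) /= /e; congr (_ :: _); apply/eqP; rewrite -size_eq0 size_filter.
  rewrite -leqn0 leqNgt -has_count; apply/hasPn => j; rewrite mem_iota => /andP[j0 _].
  by rewrite -eqn0Ngt -lt0n.
have qE : (blk e r).+1 = r by have := size_cols r e; rewrite colsE => -[].
have := scroll_hilb_poly k r e; rewrite qE colsE => HQ.
have minE : minors e (fun i => 'X_i : {mpoly k[r.+1]}) = [::].
  by rewrite /minors colsE.
rewrite minE in HQ.
have le : eventually (fun d => P.[d%:R] <= (scroll_poly r 1).[d%:R]).
  apply: hilb_poly_le HP HQ => d h h' Hh Hh'; apply: hilb_fun_mono Hh Hh' => f /gen_ideal_nil->.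
  exact: ideal0.
have szQ : size (scroll_poly r 1) = r.+1 by rewrite size_scroll_poly.
rewrite -[X in _ <= X](lead_coef_scroll_poly r0 (ltn0Sn 0)).
apply: ler_wpM2r; first exact: ler0n.
by apply: eventually_le_lead_coef => //; rewrite szQ.
Qed.

Lemma gen_ideal_homog (k : closedFieldType) m (xs : seq 'rV[k]_m) d f :
  <<xs>>%VS = fullv -> (0 < d)%N -> homog_deg d f -> gen_ideal (map (@lform k m) xs) f.
Proof.
move=> xsfull d0 /dhomogP homf; have iI := gen_ideal_ideal (map (@lform k m) xs).
have linI u : gen_ideal (map (@lform k m) xs) (lform u).
  have : u \in <<in_tuple xs>>%VS by rewrite /= xsfull memvf.
  move/coord_span=> ->.
  have lf0 : lform (0 : 'rV[k]_m) = 0 by rewrite -(scale0r 0) lformZ scale0r.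
  rewrite (big_morph (@lform k m) (@lformD k m) lf0); apply: ideal_sum => // i _.
  by rewrite lformZ; apply: idealZ => //; apply/gen_ideal_mem/map_f/mem_nth.
rewrite [f]mpolyE big_seq; apply: ideal_sum => // a /homf /= dega; apply: idealZ => //.
have [i ai] : exists i, (0 < a i)%N.
  apply/existsP; move: d0; apply: contraTT => /existsPn a0.
  rewrite -dega mdegE big1 // => i _; apply/eqP; by have := a0 i; rewrite -eqn0Ngt.
have le1 : (U_(i) <= a)%MM by rewrite lep1mP -lt0n.
by rewrite -(submK le1) mpolyXD -(lformX k i); apply: idealMl.
Qed.

Lemma koszul_exact_catl (k : closedFieldType) m (I : {mpoly k[m]} -> Prop) zs xs i :
  ideal I -> (forall d f, I f -> I (pihomog mdeg d f)) ->
  (forall y, y \in zs ++ xs -> homog_deg 1 y) ->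
  koszul_exact I (zs ++ xs) (size zs + i) -> koszul_exact I xs i.
Proof.
move=> iI homI; elim: zs => // z zs IH hom /= ex.
apply: IH; first by move=> y yin; apply: hom; rewrite inE yin orbT.
exact: koszul_exact_behead ex.
Qed.

Lemma size_basis_seq (k : fieldType) (U : vectType k) (W : {vspace U}) (X : seq U) :
  basis_of W X -> size X = \dim W.
Proof. by move=> bX; rewrite -(span_basis bX) (eqP (basis_free bX)). Qed.

(** * The scroll containing the image, and the depth bound *)

Section ProjectedScroll.
Variables (k : closedFieldType) (r n : nat) (a : seq nat) (A : 'M[k]_r.+2).
Hypothesis r2 : (2 <= r)%N.
Hypothesis uA : A \in unitmx.
Hypothesis sd : scroll_data r.+1 n a.
Notation e := (breaks n a).
Variable Ct : ('I_r.+2 -> k) -> Prop.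
Hypothesis CP : forall v, Ct v <-> zero_set (minors e (fun i => lform (row i A))) v.
Variables (M : 'M[k]_(r.+1, r.+2)) (p : 'I_r.+2 -> k).
Hypothesis Cp : ~ Ct p.
Hypothesis projM : projection_from M p.
Variable CX : ('I_r.+1 -> k) -> Prop.
Hypothesis CXP : forall v, CX v <-> exists w, Ct w /\ v = lapp M w.
Hypothesis amdX : almost_minimal_degree CX.
Notation nc := (size (cols r.+1 e)).
Notation up := (upper e A).
Notation lo := (lower e A).
Notation V := (center_cols e A p).
Notation q := (blk e r.+1).+1.

(** With two columns the scroll, hence X, would have dimension [r], and almost minimal degree would
    force degree 2, whereas P^r has degree 1. With more columns [V] is non-zero, so there is a chain
    to build Y from. *)
Lemma image_dimension : (2 < nc)%N /\ proj_dim CX q%:Z.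
Proof.
case: amdX => _ [_ [_ [D [deg [[P [HP [DE leadP]]] [_ degE]]]]]].
have szq := size_cols r.+1 e; have dimV := dim_center_cols CP Cp.
have szP : size P = q.+1.
  by rewrite (hilb_poly_image_size uA CP Cp projM CXP HP) size_scroll_poly //; lia.
split; last by exists P; split=> //; rewrite szP; lia.
rewrite ltnNge; apply/negP => nc2.
have qr : q = r by lia.
have := hilb_poly_lead_le (ltnW r2) (vanishing_ideal CX) HP; rewrite szP qr => /(_ erefl).
move: leadP; rewrite szP qr /= => ->; rewrite -[1]/(1%:R) ler_nat.
by move: degE; rewrite DE szP qr; lia.
Qed.

Variable cs : seq (seq 'rV[k]_nc).
Hypothesis nz_cs : all (fun c => c != [::]) cs.
Hypothesis bas_cs : basis_of V (flatten cs).
Hypothesis link_cs : forall c, c \in cs -> links up lo c.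
Let Fs := flatten (map (chain_forms up lo) cs).
Hypothesis free_Fs : free Fs.

Let cs_in : {subset flatten cs <= V}.
Proof. by move=> v vcs; apply: (basis_mem bas_cs). Qed.

Let Fs_entry f : f \in Fs -> exists2 v, v \in V & f = up v \/ f = lo v.
Proof.
case/flatten_mapP=> c csc; rewrite mem_rcons inE => /orP[/eqP->|/mapP[v cv ->]].
  exists (last 0 c); last by right.
  apply: cs_in; apply/flattenP; exists c => //; have := allP nz_cs c csc.
  by case: (c) => //= v c' _; apply: mem_last.
by exists v; [apply: cs_in; apply/flattenP; exists c | left].
Qed.

Let Fs_center f : f \in Fs -> (lform f).@[p] = 0.
Proof. by case/Fs_entry=> v /center_colsP[uv lv] [->|->]. Qed.

Let Fs_le : (<<Fs>> <= (up @: V) + (lo @: V))%VS.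
Proof.
apply/span_subvP => f /Fs_entry[v Vv [->|->]].
  by apply: (subvP (addvSl _ _)); apply: memv_img.
by apply: (subvP (addvSr _ _)); apply: memv_img.
Qed.

Let Fs_ge : ((up @: V) + (lo @: V) <= <<Fs>>)%VS.
Proof.
rewrite subv_add -(span_basis bas_cs) !limg_span; apply/andP; split; apply/span_subvP => f /mapP[v vcs ->];
  case/flattenP: vcs => c csc /(nthP 0)[j ltj <-];
  have [Ej ESj] := nth_chain_forms (link_cs csc) ltj; [rewrite -Ej | rewrite -ESj];
  apply/memv_span/flatten_mapP; exists c => //; apply: mem_nth; rewrite size_chain_forms ltnS //.
exact: ltnW.
Qed.

Let cs0 : cs != [::].
Proof.
have [nc3 _] := image_dimension; have := dim_center_cols CP Cp.
have := size_basis_seq bas_cs.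
by case: (cs) => //= <-; lia.
Qed.

Let Gs := map (fun f => descend M f) Fs.

Let nth_Gs j : (j < size Fs)%N -> Gs`_j *m M = Fs`_j.
Proof. by move=> ltj; rewrite (nth_map 0) // (lift_formK projM) // Fs_center // mem_nth. Qed.

Let free_Gs : free Gs.
Proof.
have mapE : map (linfun (mulmxr M)) Gs = Fs.
  rewrite -map_comp -[RHS]map_id; apply/eq_in_map => f fF /=.
  by rewrite lfunE /= (lift_formK projM) // Fs_center.
rewrite /free eqn_leq dim_span /= size_map -(eqP free_Fs).
by have := limg_ker_dim (linfun (mulmxr M)) <<Gs>>; rewrite limg_span mapE => <-; apply: leq_addl.
Qed.

(** Coordinates absent from the matrix of Y; they are also the missing variables of the depth
    estimate. *)
Let Zs : seq 'rV[k]_r.+1 := vbasis (<<Gs>>^C)%VS.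

Let bas_GZ : basis_of fullv (Gs ++ Zs).
Proof.
rewrite -(addv_complf <<Gs>>); apply: cat_basis (vbasisP _).
  by apply/directv_addP; rewrite capv_compl.
by rewrite /basis_of free_Gs eqxx.
Qed.

Let size_GZ : (size Gs + size Zs = r.+1)%N.
Proof.
by rewrite -size_cat (size_basis_seq bas_GZ) dim_rowspace.
Qed.

Let bounds := (size_entries_upper uA sd CP Cp free_Fs Fs_le,
               size_entries_lower uA sd CP Cp free_Fs Fs_ge).

Lemma scroll_containing_image : exists (CY : ('I_r.+1 -> k) -> Prop) (hY DY : int),
  [/\ is_scroll CY hY, forall v, CX v -> CY v, proj_dim CY DY, DY - q%:Z = 1
    & r%:Z - n%:Z <= hY <= r%:Z - n%:Z + 3].
Proof.
have [leF geF] := bounds.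
have [n' [a' [szF /andP[n'0 alla] sorta szcols colF]]] :=
  chains_scroll cs0 nz_cs link_cs cs_in.
rewrite -/Fs in szF colF.
have le_n'r : (n' <= r)%N.
  have szG : size Gs = n'.+1 by rewrite size_map.
  have := leq_addr (size Zs) (size Gs); rewrite size_GZ szG; exact.
have sd' : scroll_data r n' a'.
  rewrite /scroll_data n'0 le_n'r; split=> //; split=> //.
  by apply/allP => x /(allP alla)/andP[].
pose A' : 'M[k]_r.+1 := \matrix_(i < r.+1) (Gs ++ Zs)`_i.
have uA' : A' \in unitmx.
  by apply: full_basis_unitmx; [exact: basis_free bas_GZ | rewrite size_cat size_GZ].
pose e' := breaks n' a'.
pose CY := zero_set (minors e' (fun i => lform (row i A'))).
have CYP v : CY v <-> zero_set (minors e' (fun i => lform (row i A'))) v by [].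
have szc : (size (cols r e') + 2 = nc)%N.
  rewrite -(scroll_cols_breaks sd') szcols.
  by rewrite (size_basis_seq bas_cs) (dim_center_cols CP Cp).
have [nc3 _] := image_dimension.
have szq := size_cols r.+1 e; have szq' := size_cols r e'.
exists CY, (r%:Z - n'%:Z - 1), (blk e' r).+1%:Z; split.
- by apply/is_scrollP; exists A', n', a'.
- move=> v /CXP[w [Cw ->]] g /mapP[[j j']].
  rewrite mem_filter => /andP[_ /allpairsP[[i i'] [/= ci ci' [-> ->]]]] ->.
  have rowE j0 : (j0 <= n')%N -> (lform (row (inord j0) A')).@[lapp M w] = (lform Fs`_j0).@[w].
    move=> lej; have ltj : (j0 < size Fs)%N by rewrite szF ltnS.
    rewrite rowK inordK ?ltnS ?(leq_trans lej) // nth_cat size_map ltj.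
    by rewrite -subst_meval (subst_lform M) nth_Gs.
  have cE j0 : j0 \in cols r e' -> exists v0,
      (lform (row (inord j0) A')).@[lapp M w] = (lform (up v0)).@[w] /\
      (lform (row (inord j0.+1) A')).@[lapp M w] = (lform (lo v0)).@[w].
    rewrite -(scroll_cols_breaks sd') => cj; have [v0 _ [E1 E2]] := colF _ cj.
    have ltj : (j0 < n')%N by move: cj; rewrite mem_filter mem_iota => /andP[].
    by exists v0; rewrite !rowE ?(ltnW ltj) // E1 E2.
  have [v0 [E1 E2]] := cE i ci; have [v1 [E3 E4]] := cE i' ci'.
  rewrite mevalB !mevalM E1 E2 E3 E4 (pencil_minor CP v0 v1 Cw); exact: subrr.
- exists (scroll_poly (blk e' r).+1 (size (cols r e'))); split.
    exact: (scroll_cone_hilb_poly uA' CYP).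
  have nc'0 : (0 < size (cols r e'))%N by rewrite -(ltn_add2r 2) szc.
  by rewrite size_scroll_poly // subzSS subr0.
(* Columns and blocks add up to the number of coordinates: two columns less with one coordinate less
   make one block more. *)
- by clear -szq szq' szc; lia.
(* The number n' + 1 of entries lies between n - 3 and n. *)
- rewrite szF in leF geF; clear -leF geF; lia.
Qed.

Lemma depth_bound fs : regular_seq (vanishing CX) fs -> (size fs)%:Z <= (r%:Z - n%:Z) + 5.
Proof.
move=> regfs; have [leF geF] := bounds.
(* [Zs] has r + 1 - size Fs elements, hence at most r - n + 4. *)
suff : (size fs <= size Zs + 1)%N.
  by have := size_GZ; rewrite size_map; clear -geF => szZ le; lia.
rewrite leqNgt; apply/negP => lt_fs.
have homX d f : vanishing CX f -> vanishing CX (pihomog mdeg d f).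
  by apply: vanishing_pihomog => v c; apply: CX_scale.
have iX := vanishing_ideal CX.
(* [Zs] comes first because [koszul_exact_catl] strips variables from the front, at the cost of one
   degree each. *)
pose xs := map (@lform k r.+1) (Zs ++ Gs).
have full : <<Zs ++ Gs>>%VS = fullv.
  by rewrite span_cat addvC -span_cat; apply: span_basis bas_GZ.
have spanfs f : f \in fs -> gen_ideal xs f.
  by case: regfs => + _ => /[apply] -[d [d0 homf]]; apply: gen_ideal_homog full d0 homf.
have := regular_seq_koszul_exact iX spanfs regfs lt_fs.
rewrite /xs map_cat -(size_map (@lform k r.+1) Zs) => /(koszul_exact_catl iX homX) ex1.
have {}ex1 : koszul_exact (vanishing CX) (map (@lform k r.+1) Gs) 1.
  by apply: ex1 => y; rewrite -map_cat => /mapP[u _ ->]; apply: lform_homog.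
have [y [yp _ condy]] := center_form CP Cp projM.
have [G GP] : exists G : 'I_(size Fs) -> {mpoly k[r.+1]}, forall j : 'I_(size Fs),
    forall w, Ct w -> (G j).@[lapp M w] = (lform Fs`_j).@[w] * (lform y).@[w].
  apply: (@fin_all_exists _ _ (fun (j : 'I_(size Fs)) G => forall w, Ct w ->
    G.@[lapp M w] = (lform Fs`_j).@[w] * (lform y).@[w])) => j.
  have /Fs_entry[v /condy[cu mclass] [->|->]] : Fs`_j \in Fs by apply: mem_nth.
    exact: cu.
  exact: mclass.
have xsE j w : (j < size Fs)%N ->
    ((map (@lform k r.+1) Gs)`_j).@[lapp M w] = (lform Fs`_j).@[w].
  move=> ltj; rewrite (nth_map 0) ?size_map // -subst_meval (subst_lform M) nth_Gs //.
have [|||b bP] := @koszul_exact1_conductor k r.+1 _ Ct (lapp M)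
    (fun w => (lform y).@[w]) _ _ (codom G) _ _ _ ex1.
- move=> f; split=> [vf w Cw|vf v /CXP[w [Cw ->]]]; last exact: vf.
  by apply: vf; apply/CXP; exists w.
- by rewrite size_codom card_ord !size_map.
- move=> w j Cw; rewrite !size_map => ltj; rewrite xsE //.
  apply: etrans (GP (Ordinal ltj) w Cw).
  rewrite codomE (nth_map (Ordinal ltj)) ?size_enum_ord //.
  by congr (meval _ (G _)); apply: val_inj; rewrite /= nth_enum_ord.
have F0 : (0 < size Fs)%N.
  by rewrite /Fs; case: (cs) cs0 => // c cs' _; rewrite /= size_cat size_chain_forms.
(* The first entry does not vanish identically on the scroll, whose ideal is prime, so [y] agrees
   there with the pull-back of [b]. *)
have : vanishing Ct (lform Fs`_0 * (lform y - subst M b)).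
  move=> w Cw; rewrite mevalM mevalB subst_meval -xsE //.
  by apply: bP => //; rewrite !size_map.
case/(scroll_cone_prime uA CP) => [/(scroll_cone_nondegenerate uA CP) F00|vy].
  by have := free_not0 free_Fs (mem_nth 0 F0); rewrite F00 eqxx.
(* In degree one, [y] would be the pull-back of a linear form on P^r and so vanish at [p], where its
   value is 1. *)
have /(vanishing_pihomog 1 (fun v c => @scroll_cone_scale _ _ _ _ _ CP v c)) := vy.
rewrite linearB /= pihomog_subst (pihomog_dE (lform_homog y)).
have [u ->] := homog1_lform (pihomogP mdeg 1 b).
rewrite (subst_lform M) -scaleN1r -lformZ -lformD.
move=> /(scroll_cone_nondegenerate uA CP) yM.
have := congr1 (fun u0 => (lform u0).@[p]) yM.
rewrite lformD mevalD lformZ mevalZ (lform_center projM) yp mulr0 addr0 => /eqP.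
by rewrite lform_meval big1 ?oner_eq0 // => j _; rewrite mxE mul0r.
Qed.

End ProjectedScroll.

Theorem theorem7p5 (k : closedFieldType) (r : nat) (h : int)
  (Ct : ('I_r.+2 -> k) -> Prop) (CX : ('I_r.+1 -> k) -> Prop)
  (M : 'M[k]_(r.+1, r.+2)) (p : 'I_r.+2 -> k) :
  (2 <= r)%N ->
  is_scroll Ct h ->
  ~ Ct p ->
  projection_from M p ->
  (forall v, CX v <-> exists w, Ct w /\ v = lapp M w) ->
  almost_minimal_degree CX ->
  (exists (CY : ('I_r.+1 -> k) -> Prop) (hY DX DY : int),
      is_scroll CY hY /\ (forall v, CX v -> CY v) /\
      proj_dim CX DX /\ proj_dim CY DY /\ DY - DX = 1 /\
      h <= hY <= h + 3) /\
  (exists t : nat, arith_depth CX t /\ t%:Z <= h + 5).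
Proof.
move=> r2 /is_scrollP[A [n [a [uA sd hE CP]]]] Cp projM CXP amdX.
have {}hE : h = r%:Z - n%:Z by lia.
have [cs [nz_cs bas_cs link_cs free_cs]] := kronecker_chains
  (fun v s t (_ : v \in center_cols (breaks n a) A p) => @pencil_injective _ _ _ _ uA _ CP v s t).
have [_ dimX] := image_dimension r2 uA CP Cp projM CXP amdX.
split.
  have [CY [hY [DY [scY XY dimY DYE hYE]]]] :=
    scroll_containing_image r2 uA sd CP Cp projM CXP amdX nz_cs bas_cs link_cs free_cs.
  by exists CY, hY, (blk (breaks n a) r.+1).+1%:Z, DY; rewrite hE.
have bound fs : regular_seq (vanishing CX) fs -> (size fs)%:Z <= h + 5.
  rewrite hE; exact: (depth_bound r2 uA sd CP Cp projM CXP amdX nz_cs bas_cs link_cs free_cs).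
have reg0 : regular_seq (vanishing CX) [::].
  do 2!split=> //; case: amdX => _ [[nX1 _] _].
  by move=> /ideal_plus_nil.
(* The integer h + 5 = r - n + 5 is at most r + 5, a natural number that bounds the search for the
   maximal length. *)
have [||t [[fs [regfs szfs]] maxt]] := @bounded_max
  (fun t => exists fs, regular_seq (vanishing CX) fs /\ size fs = t) (r + 5)%N.
- by exists [::].
- by move=> t [fs [/bound + <-]]; rewrite hE; clear; lia.
exists t; split; last by rewrite -szfs; apply: bound.
split; first by exists fs.
by move=> gs reggs; apply: maxt; exists gs.
Qed.
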